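(* Let $R$ be the ring of integers of an algebraic number field, and assume that $R$ is a PID. Let $\mathcal{M}$ be a realizable $R$-matroid of rank $r$ on the ground set $[n]$ (with a fixed realization). Let $N_{\mathcal{M}}(t)$ be the Hilbert series of its face module $N_{\mathcal{M}}$. Then \[ N_{\mathcal{M}}(t)=\frac{t^r}{(1-t)^r}\,\tilde T_{\mathcal{M}}\left(\tfrac1t,1\right). \]
   Context: $[n]=\{1,\dots,n\}$. An algebraic number field is a finite extension $\mathbb{F}$ of $\mathbb{Q}$; its ring of integers $R$ is the integral closure of $\mathbb{Z}$ in $\mathbb{F}$, and $Q(R)=\mathbb{F}$. A realizable $R$-matroid on $[n]$ is an assignment $A\mapsto\mathcal{M}(A)$ of finitely generated $R$-modules to the subsets $A\subseteq[n]$ for which there is a map $\psi:[n]\to\mathcal{M}(\emptyset)$ (a realization, which is fixed) with $\mathcal{M}(A)=\mathcal{M}(\emptyset)/(\psi(i):i\in A)$ for all $A$. Rank: $\operatorname{rk}(A)=\dim_{Q(R)}(\mathcal{M}(\emptyset)\otimes Q(R))-\dim_{Q(R)}(\mathcal{M}(A)\otimes Q(R))$; the rank of $\mathcal{M}$ is $r=\operatorname{rk}([n])$; $\Delta\mathcal{M}=\{A\subseteq[n]:\operatorname{rk}(A)=|A|\}$. $\operatorname{tor}(A)$ is the torsion submodule of $\mathcal{M}(A)$ (a finite set here) and $\operatorname{tor}(A)^\vee=\operatorname{Hom}_R(\operatorname{tor}(A),Q(R)/R)$. $\tilde T_{\mathcal{M}}(x,y)=\sum_{A\subseteq[n]}|\operatorname{tor}(A)^\vee|(x-1)^{r-\operatorname{rk}(A)}(y-1)^{|A|-\operatorname{rk}(A)}\in\mathbb{Z}[x,y]$.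 (It is the image of the Tutte polynomial $\sum_A[\operatorname{tor}(A)^\vee](x-1)^{r-\operatorname{rk}(A)}(y-1)^{|A|-\operatorname{rk}(A)}$ under the ring map sending the class of every free module to $1$ and the class of every torsion module to its cardinality.) Poset of torsions: for $b\in[n]\setminus A$ with $A\cup\{b\}\in\Delta\mathcal{M}$, the quotient map $\mathcal{M}(A)\to\mathcal{M}(A\cup\{b\})=\mathcal{M}(A)/(\psi(b))$ restricts to an injection $\pi_{A,b}:\operatorname{tor}(A)\to\operatorname{tor}(A\cup\{b\})$, with dual $\pi_{A,b}^\vee:\operatorname{tor}(A\cup\{b\})^\vee\to\operatorname{tor}(A)^\vee$. $\operatorname{Gr}\mathcal{M}=\{(A,l):A\in\Delta\mathcal{M},\ l\in\operatorname{tor}(A)^\vee\}$, with the partial order generated by the covering relations $(A,l)\triangleleft(A\cup\{b\},h)\iff\pi_{A,b}^\vee(h)=l$. Let $e$ be the zero element of $\operatorname{tor}(\emptyset)^\vee$ and $L=\{b\in\operatorname{Gr}\mathcal{M}:b\ge(\emptyset,e)\}$ the link of $(\emptyset,e)$; $L$ is a simplicial poset, i.e. it has a minimum $\hat0$ and each interval $[\hat0,a]$ is a boolean lattice; the rank of $a$ is the rank of this lattice. Face ring: fix a field $\mathbb{K}$. For a simplicial poset $P$, let $M(a,b)$ be the set of minimal upper bounds of $\{a,b\}$, let $a\wedge b$ be the meet, and let \[I_P=\Big(x_{\hat0}-1,\ x_ax_b-x_{a\wedge b}\sum_{c\in M(a,b)}x_c\ :\ a,b\in P\Big)\subseteq\mathbb{K}[x_a:a\in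 P],\] with $x_{a\wedge b}=0$ if $a\wedge b$ does not exist and the sum equal to $0$ if $M(a,b)=\emptyset$. The face ring is $A_P=\mathbb{K}[x_a:a\in P]/I_P$, graded by $\deg x_a=\operatorname{rk}(a)$. The face module of $\mathcal{M}$ is the graded $A_L$-module $N_{\mathcal{M}}=A_L^{|\operatorname{tor}(\emptyset)|}$, and its Hilbert series is $N_{\mathcal{M}}(t)=\sum_{i\ge0}\dim_{\mathbb{K}}(N_{\mathcal{M}})_i\,t^i$. *)

(* Defs.v *)
From HB Require Import structures.
From mathcomp Require Import all_boot all_order all_algebra all_field.
From mathcomp Require Import generic_quotient ring_quotient.
From mathcomp Require Import finmap.
From mathcomp Require Import boolp classical_sets functions cardinality fsbigop.
From mathcomp Require Import monalg.
From Stdlib Require Import Relation_Operators.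

Set Implicit Arguments.
Unset Strict Implicit.
Unset Printing Implicit Defensive.

Import Order.TTheory GRing.Theory.
Local Open Scope ring_scope.
Local Open Scope quotient_scope.
Local Open Scope classical_set_scope.

Section Span.
Variables (R : pzRingType) (M : lmodType R).

Definition span (G : set M) : set M :=
  [set x | exists s : seq (R * M),
     (forall p, p \in s -> G p.2) /\ x = \sum_(p <- s) p.1 *: p.2].

Definition finitely_generated := exists s : seq M, forall x : M, span [set` s] x.

Lemma span_subset (G H : set M) : G `<=` H -> span G `<=` span H.
Proof. by move=> GH x [s [sG ->]]; exists s; split=> // p /sG /GH. Qed.

Variable G : set M.

Definition span_pred : {pred M} := fun x => `[< span G x >].

Lemma span_closed : submod_closed span_pred.
Proof.
split; first by apply/asboolP; exists [::]; rewrite big_nil.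
move=> a x y /asboolP [s [sG ->]] /asboolP [t [tG ->]]; apply/asboolP.
exists ([seq (a * p.1, p.2) | p <- s] ++ t); split.
  move=> p; rewrite mem_cat => /orP[/mapP[q qs ->]|/tG//] /=; exact: sG.
rewrite big_cat big_map scaler_sumr; congr (_ + _).
by apply: eq_bigr => p _; rewrite scalerA.
Qed.

HB.instance Definition _ := GRing.isSubmodClosed.Build R M span_pred
  (GRing.submod_closed_semi span_closed).

Definition quotmod := {ideal_quot span_pred}.

HB.instance Definition _ := GRing.Zmodule.on quotmod.
HB.instance Definition _ := EqQuotient.on quotmod.

Definition qproj (x : M) : quotmod := \pi_quotmod x.

Lemma qproj_eq x y : (qproj x == qproj y) = (x - y \in span_pred).
Proof. exact/esym/(Quotient.idealrBE span_pred). Qed.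

Lemma qprojD : {morph qproj : x y / x + y}.
Proof. exact: (Quotient.pi_add span_pred). Qed.

Definition qscale (a : R) (x : quotmod) : quotmod := qproj (a *: repr x).

Lemma qprojZ a x : qproj (a *: x) = qscale a (qproj x).
Proof.
by apply/eqP; rewrite qproj_eq -scalerBr rpredZ // -qproj_eq /qproj reprK.
Qed.

Lemma qprojP (x : quotmod) : exists y, x = qproj y.
Proof. by exists (repr x); rewrite /qproj reprK. Qed.

Lemma qscaleA a b x : qscale a (qscale b x) = qscale (a * b) x.
Proof. by have [y ->] := qprojP x; rewrite -!qprojZ scalerA. Qed.
Lemma qscale1 : left_id 1 qscale.
Proof. by move=> x; have [y ->] := qprojP x; rewrite -qprojZ scale1r. Qed.
Lemma qscaleDr : right_distributive qscale +%R.
Proof.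
move=> a x y; have [x' ->] := qprojP x; have [y' ->] := qprojP y.
by rewrite -qprojD -!qprojZ scalerDr qprojD.
Qed.
Lemma qscaleDl x : {morph qscale^~ x : a b / a + b}.
Proof.
by move=> a b; have [y ->] := qprojP x; rewrite -!qprojZ scalerDl qprojD.
Qed.

HB.instance Definition _ :=
  GRing.Zmodule_isLmodule.Build R quotmod qscaleA qscale1 qscaleDr qscaleDl.

Lemma qproj_linear : linear qproj.
Proof. by move=> a x y; rewrite qprojD qprojZ. Qed.

HB.instance Definition _ := GRing.isLinear.Build R M quotmod _ qproj qproj_linear.

Lemma qproj0P x : qproj x = 0 <-> span G x.
Proof.
rewrite -[X in _ = X](raddf0 qproj); split=> [/eqP|xG].
  by rewrite qproj_eq subr0 => /asboolP.
by apply/eqP; rewrite qproj_eq subr0; apply/asboolP.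
Qed.

End Span.

(* For G contained in H, the projection from M/<G> onto M/<H>. *)
Definition quot_map (R : pzRingType) (M : lmodType R) (G H : set M)
  (x : quotmod G) : quotmod H := qproj H (repr x).

Lemma quot_map_qproj (R : pzRingType) (M : lmodType R) (G H : set M) (x : M) :
  G `<=` H -> quot_map H (qproj G x) = qproj H x.
Proof.
move=> GH; apply/eqP; rewrite /quot_map qproj_eq; apply/asboolP.
apply: (span_subset GH); apply/asboolP.
have := eqxx (qproj G x).
by rewrite -[X in X == _]reprK -/(qproj G _) qproj_eq.
Qed.

Lemma quot_map_linear (R : pzRingType) (M : lmodType R) (G H : set M) :
  G `<=` H -> linear (@quot_map R M G H).
Proof.
move=> GH a x y; have [x' ->] := qprojP x; have [y' ->] := qprojP y.
by rewrite -linearP !quot_map_qproj // linearP.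
Qed.

(* The S-module V, viewed as an R-module through f. *)
Definition restriction (R S : pzRingType) (f : {rmorphism R -> S})
  (V : lmodType S) : Type := V.

Section Restriction.
Variables (R S : pzRingType) (f : {rmorphism R -> S}) (V : lmodType S).
Local Notation restriction := (restriction f V).

HB.instance Definition _ := GRing.Zmodule.on restriction.

Definition rscale (a : R) (x : restriction) : restriction := f a *: (x : V).

Lemma rscaleA a b x : rscale a (rscale b x) = rscale (a * b) x.
Proof. by rewrite /rscale scalerA rmorphM. Qed.
Lemma rscale1 : left_id 1 rscale.
Proof. by move=> x; rewrite /rscale rmorph1 scale1r. Qed.
Lemma rscaleDr : right_distributive rscale +%R.
Proof. by move=> a x y; rewrite /rscale scalerDr. Qed.
Lemma rscaleDl x : {morph rscale^~ x : a b / a + b}.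
Proof. by move=> a b; rewrite /rscale rmorphD scalerDl. Qed.

HB.instance Definition _ := GRing.Zmodule_isLmodule.Build R restriction
  rscaleA rscale1 rscaleDr rscaleDl.

End Restriction.

Section Dimension.
Variables (K : fieldType) (V : lmodType K).

Definition has_dim (U : set V) (d : nat) := exists b : 'I_d -> V,
  [/\ forall i, U (b i),
      forall x, U x -> span (range b) x
    & forall c : 'I_d -> K, \sum_i c i *: b i = 0 -> forall i, c i = 0].

Definition finite_dim (U : set V) := exists d, has_dim U d.

(* The dimension of the subspace U, 0 by convention if it is infinite. *)
Definition vdim (U : set V) : nat := xget 0%N [set d | has_dim U d].

End Dimension.

Section BaseChange.
Variables (R : nzRingType) (F : fieldType) (f : {rmorphism R -> F}).
Variable M : lmodType R.

(* M (x)_R F, by generators and relations: the F-vector space on the symbols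
   <<x>> (standing for x (x) 1), x in M, modulo R-linearity in x. *)
Definition base_change_rel : set {malg F[M]} :=
  [set u | (exists x y : M, u = << (x + y) >> - << x >> - << y >>)
        \/ (exists (a : R) (x : M), u = << (a *: x) >> - f a *: << x >>)].

Definition base_change := quotmod base_change_rel.
HB.instance Definition _ := GRing.Lmodule.on base_change.

Definition generic_rank : nat := vdim [set: base_change].

End BaseChange.

Section Torsion.
Variables (R : idomainType) (M : lmodType R).

Definition torsion_pred : {pred M} :=
  fun x => `[< exists2 a : R, a != 0 & a *: x = 0 >].

Lemma torsion_closed : submod_closed torsion_pred.
Proof.
split; first by apply/asboolP; exists 1; rewrite ?oner_neq0 ?scaler0.
move=> c x y /asboolP[a a0 ax] /asboolP[b b0 bx]; apply/asboolP.
exists (a * b); first by rewrite mulf_neq0.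
rewrite scalerDr -[X in _ + X]scalerA bx scaler0 addr0 scalerA.
by rewrite mulrC mulrA mulrC -!scalerA ax !scaler0.
Qed.

HB.instance Definition _ := GRing.isSubmodClosed.Build R M torsion_pred
  (GRing.submod_closed_semi torsion_closed).

Definition torsion := {x : M | x \in torsion_pred}.
HB.instance Definition _ := SubChoice.on torsion.
HB.instance Definition _ := [SubChoice_isSubLmodule of torsion by <:].

End Torsion.

Lemma torsion_map_subproof (R : idomainType) (M : lmodType R) (G H : set M)
  (GH : G `<=` H) (x : torsion (quotmod G)) :
  quot_map H (\val x) \in @torsion_pred R (quotmod H).
Proof.
have /asboolP [a a0 ax] := valP x; apply/asboolP; exists a => //.
have [y xE] := qprojP (\val x).
move: ax; rewrite xE quot_map_qproj // -!linearZ => /qproj0P ax.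
exact/qproj0P/(span_subset GH).
Qed.

(* The map tor(M/<G>) -> tor(M/<H>) induced by the projection, G `<=` H. *)
Definition torsion_map (R : idomainType) (M : lmodType R) (G H : set M)
  (GH : G `<=` H) (x : torsion (quotmod G)) : torsion (quotmod H) :=
  Sub (quot_map H (\val x)) (torsion_map_subproof GH x).

Lemma torsion_map_linear (R : idomainType) (M : lmodType R) (G H : set M)
  (GH : G `<=` H) : linear (torsion_map GH).
Proof. by move=> a x y; apply: val_inj; rewrite linearP /= quot_map_linear. Qed.

HB.instance Definition _ (R : idomainType) (M : lmodType R) (G H : set M)
  (GH : G `<=` H) := GRing.isLinear.Build R _ _ _ (torsion_map GH)
    (torsion_map_linear GH).

(* iota identifies R with the integral closure of Z in F. *)
Definition ring_of_integers (F : fieldExtType rat) (R : idomainType)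
    (iota : {rmorphism R -> F}) :=
  injective iota /\
  forall x : F, integralOver (intr : int -> F) x <-> exists a : R, x = iota a.

Definition is_PID (R : idomainType) := forall I : set R,
  I 0 -> (forall a x y, I x -> I y -> I (a * x + y)) ->
  exists g, I = [set a * g | a in [set: R]].

Section Dual.
Variables (F : fieldType) (R : idomainType) (iota : {rmorphism R -> F}).

(* F/R, as an R-module; this is Q(R)/R when F is the fraction field of R. *)
Definition frac_mod := @quotmod R (restriction iota F^o) (range iota).
HB.instance Definition _ := GRing.Lmodule.on frac_mod.

(* tor(N)^v = Hom_R(tor(N), F/R) for an R-module N *)
Definition dual (N : lmodType R) : Type := {linear torsion N -> frac_mod}.
HB.instance Definition _ N := gen_eqMixin (dual N).
HB.instance Definition _ N := gen_choiceMixin (dual N).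

Lemma dual_ext N (g h : dual N) :
  (g : {linear _ -> _}) =1 (h : {linear _ -> _}) -> g = h.
Proof.
move: g h => [g [[g1] [g2]]] [h [[h1] [h2]]] gh.
have {}gh : g = h by apply/funext.
by subst h; rewrite (Prop_irrelevance g1 h1) (Prop_irrelevance g2 h2).
Qed.

Definition dual0 N : dual N := (\0 : {linear torsion N -> frac_mod}).

Definition dual_map (M : lmodType R) (G H : set M) (GH : G `<=` H)
  (h : dual (quotmod H)) : dual (quotmod G) :=
  ((h : {linear _ -> _}) \o torsion_map GH : {linear _ -> _}).

End Dual.

(* The data determining a realizable matroid: the module of the empty set and
   the realization. The module of A is then the quotient mat_at A below; for
   A empty this is the quotient of mat_module by its zero submodule. *)
Record realizable_matroid (R : idomainType) (n : nat) := RealizableMatroid {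
  mat_module : lmodType R;
  mat_fg : finitely_generated mat_module;
  mat_psi : 'I_n -> mat_module
}.

Section Matroid.
Variables (F : fieldType) (R : idomainType) (iota : {rmorphism R -> F}).
Variables (n : nat) (M : realizable_matroid R n).
Implicit Types A B : {set 'I_n}.

Definition mat_gens A : set (mat_module M) := mat_psi M @` [set` A].

Definition mat_at A : lmodType R := quotmod (mat_gens A).

Lemma mat_gens_subset A B : A \subset B -> mat_gens A `<=` mat_gens B.
Proof. by move=> /fintype.subsetP AB x [i /= /AB iB <-]; exists i. Qed.

(* The truncated difference is harmless: the second rank is at most the first. *)
Definition mat_rk A : nat :=
  (generic_rank iota (mat_at finset.set0) - generic_rank iota (mat_at A))%N.

Definition mat_rank : nat := mat_rk [set: 'I_n]%SET.

Definition mat_indep A := mat_rk A == #|A|.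

Lemma mat_indep0 : mat_indep finset.set0.
Proof. by rewrite /mat_indep /mat_rk subnn cards0. Qed.

Definition card_tor A : nat := #|` fset_set [set: torsion (mat_at A)]|%fset.

Definition tor_dual A := dual iota (mat_at A).

Definition card_tor_dual A : nat := #|` fset_set [set: tor_dual A]|%fset.

(* The outer variable 'X is x and the inner variable 'Y is y. *)
Definition tutte_poly : {poly {poly int}} :=
  \sum_(A : {set 'I_n}) (card_tor_dual A)%:R
     * ('X - 1) ^+ (mat_rank - mat_rk A) * ('Y - 1) ^+ (#|A| - mat_rk A).

(* pi_{A,B}^v : tor(B)^v -> tor(A)^v, for A \subset B *)
Definition tor_dual_map A B (AB : A \subset B) : tor_dual B -> tor_dual A :=
  dual_map (mat_gens_subset AB).

Record Gr := MkGr {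
  gr_set : {set 'I_n};
  gr_indep : mat_indep gr_set;
  gr_char : tor_dual gr_set
}.

HB.instance Definition _ := gen_eqMixin Gr.
HB.instance Definition _ := gen_choiceMixin Gr.

Definition gr_cover (g h : Gr) := exists b : 'I_n,
  [/\ b \notin gr_set g, gr_set h = b |: gr_set g
    & exists sgh : gr_set g \subset gr_set h,
        tor_dual_map sgh (gr_char h) = gr_char g].

Definition gr_le : Gr -> Gr -> Prop := clos_refl_trans Gr gr_cover.

Lemma gr_le_card g h : gr_le g h -> g = h \/ (#|gr_set g| < #|gr_set h|)%N.
Proof.
elim=> [x y [b [bx yE _]]|x|x y z _ [->|xy] _ [<-|yz]].
- by right; rewrite yE cardsU1 bx.
- by left.
- by left.
- by right.
- by right.
- by right; apply: ltn_trans yz.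
Qed.

Definition gr_leb (g h : Gr) := `[< gr_le g h >].

Lemma gr_leb_refl : reflexive gr_leb.
Proof. by move=> g; apply/asboolP; apply: rt_refl. Qed.

Lemma gr_leb_anti : antisymmetric gr_leb.
Proof.
move=> g h /andP[/asboolP/gr_le_card gh /asboolP/gr_le_card hg].
case: gh hg => // lt1 [//|lt2].
by have := ltn_trans lt1 lt2; rewrite ltnn.
Qed.

Lemma gr_leb_trans : transitive gr_leb.
Proof.
move=> h g k /asboolP gh /asboolP hk; apply/asboolP; exact: rt_trans hk.
Qed.

Fact gr_display : Order.disp_t. Proof. exact: Order.Disp tt tt. Qed.

HB.instance Definition _ :=
  Order.Le_isPOrder.Build gr_display Gr gr_leb_refl gr_leb_anti gr_leb_trans.

Definition gr0 : Gr := MkGr mat_indep0 (dual0 iota (mat_at finset.set0)).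

Definition link := {g : Gr | (gr0 <= g)%O}.

HB.instance Definition _ := SubChoice.on link.
HB.instance Definition _ := [SubChoice_isSubPOrder of link by <: with gr_display].

Definition link0 : link := Sub gr0 (lexx gr0).

Lemma link_le0 (x : link) : (link0 <= x)%O.
Proof. by case: x. Qed.

HB.instance Definition _ := Order.hasBottom.Build gr_display link link_le0.

End Matroid.

(* Locked, to keep unification away from the representation of monomials. *)
HB.lock Definition pvar (K : fieldType) (P : choiceType) (a : P) :
  {malg K[{cmonom P}]} := << ucm a >>.

Section FaceRing.
Variables (K : fieldType) (d : Order.disp_t) (P : bPOrderType d).
Implicit Types a b c : P.

(* The rank k of the interval [\bot, a] when it is a boolean lattice,
   i.e. is isomorphic to the lattice of subsets of 'I_k. *)
Definition boolean_interval a (k : nat) := exists f : {set 'I_k} -> P,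
  (forall S T, (f S <= f T)%O = (S \subset T))
  /\ (forall x, (x <= a)%O <-> exists S, f S = x).

Definition prank a : nat := xget 0%N [set k | boolean_interval a k].

Definition is_meet a b m :=
  [/\ (m <= a)%O, (m <= b)%O
    & forall x, (x <= a)%O -> (x <= b)%O -> (x <= m)%O].

Definition min_upper_bounds a b : set P :=
  [set c | [/\ (a <= c)%O, (b <= c)%O
             & forall x, (a <= x)%O -> (b <= x)%O -> (x <= c)%O -> x = c]].

Local Notation S := {malg K[{cmonom P}]}.

Local Notation pvar := (pvar K).

Definition meet_var a b : S :=
  if `[< exists m, is_meet a b m >] then pvar (xget \bot%O (is_meet a b))
  else 0.

(* \sum_(c \in C) is 0 by convention when C is infinite; in the link, which is
   a finite poset, the sums are the expected ones. *)
Definition face_rel : set S :=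
  [set p | p = pvar \bot%O - 1 \/
     exists a b, p = pvar a * pvar b
                     - meet_var a b * \sum_(c \in min_upper_bounds a b) pvar c].

(* I_P; the submodules of S^o (S as a module over itself) are the ideals. *)
Definition face_ideal : {pred S} := @span_pred S S^o face_rel.

Section Proper.

(* The evaluation at pvar \bot := 1 and pvar a := 0 for a != \bot. *)
Definition bot_monom (m : {cmonom P}) : K :=
  (finsupp m `<=` [fset \bot%O])%fset%:R.

Lemma bot_monom_mmorphism : mmorphism bot_monom.
Proof.
split=> [m1 m2|]; last by rewrite /bot_monom mdom1 fsub0set.
by rewrite /bot_monom mdomD fsubUset -mulnb natrM.
Qed.

HB.instance Definition _ :=
  isMultiplicative.Build {cmonom P} K bot_monom bot_monom_mmorphism.

Definition bot_eval : S -> K := mmap idfun bot_monom.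
HB.instance Definition _ := GRing.RMorphism.on bot_eval.

Lemma bot_evalB : {morph bot_eval : p q / p - q}.
Proof. exact: rmorphB. Qed.
Lemma bot_evalM : {morph bot_eval : p q / p * q}.
Proof. exact: rmorphM. Qed.
Lemma bot_evalBM p q u v : bot_eval (p * q - u * v) =
  bot_eval p * bot_eval q - bot_eval u * bot_eval v.
Proof. by rewrite bot_evalB; congr (_ - _); apply: bot_evalM. Qed.
Lemma bot_eval1 : bot_eval 1 = 1.
Proof. exact: rmorph1. Qed.

Lemma bot_eval_sum (I : eqType) (s : seq I) (f : I -> S) :
  (forall i, i \in s -> bot_eval (f i) = 0) -> bot_eval (\sum_(i <- s) f i) = 0.
Proof.
by move=> f0; rewrite [LHS]raddf_sum big_seq big1 // => i /f0.
Qed.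

Lemma bot_eval_pvar a : bot_eval (pvar a) = (a == \bot%O)%:R.
Proof. by rewrite pvar.unlock /bot_eval mmapU mul1r /= /bot_monom mdomU fsub1set inE. Qed.

Lemma bot_eval_meet0 b : bot_eval (meet_var \bot%O b) = 1.
Proof.
rewrite /meet_var; have meet0 : is_meet \bot%O b \bot%O.
  by split=> //; rewrite le0x.
case: asboolP => [|[]]; last by exists \bot%O.
move=> ex; rewrite bot_eval_pvar; case: xgetP => [x _ []|]; last by move=> /(_ _ meet0).
by rewrite lex0 => /eqP-> _ _; rewrite eqxx.
Qed.

Lemma min_upper_bounds0 b : min_upper_bounds \bot%O b = [set b].
Proof.
apply/seteqP; split=> c /=; last first.
  by move=> ->; split=> [||x _ bx xb]; rewrite ?le0x //; apply/le_anti/andP.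
by case=> _ bc /(_ b (le0x b) (lexx b) bc) ->.
Qed.

Lemma meet_varC a b : meet_var a b = meet_var b a.
Proof.
rewrite /meet_var; suff -> : is_meet a b = is_meet b a by [].
by apply/funext => m; apply/propext; split=> -[? ? h]; split=> // x ? ?; apply: h.
Qed.

Lemma min_upper_boundsC a b : min_upper_bounds a b = min_upper_bounds b a.
Proof.
by apply/funext => m; apply/propext; split=> -[? ? h]; split=> // x ? ?; apply: h.
Qed.

Lemma bot_eval_rel p : face_rel p -> bot_eval p = 0.
Proof.
case=> [->|[a [b ->]]].
  by rewrite bot_evalB bot_eval_pvar bot_eval1 eqxx subrr.
have bot0 c : bot_eval (pvar \bot%O * pvar c
    - meet_var \bot%O c * \sum_(x \in min_upper_bounds \bot%O c) pvar x) = 0.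
  rewrite min_upper_bounds0 fsbig_set1 bot_evalBM bot_eval_meet0.
  by rewrite (bot_eval_pvar \bot%O) eqxx !mul1r subrr.
have [->|a0] := eqVneq a \bot%O; first exact: bot0.
have [->|b0] := eqVneq b \bot%O.
  by rewrite [X in X - _]mulrC meet_varC min_upper_boundsC bot0.
set sum := \sum_(c \in _) _.
suff sum0 : bot_eval sum = 0.
  rewrite bot_evalBM sum0.
  by rewrite (bot_eval_pvar a) (negPf a0) mul0r mulr0 subrr.
rewrite /sum; case: finite_supportP => [|X XP _ _].
  by rewrite big_nil => _; exact: (raddf0 bot_eval).
apply: bot_eval_sum => c /XP [ac _ _].
rewrite bot_eval_pvar; case: eqVneq => // cE.
by move: ac; rewrite cE lex0 (negPf a0).
Qed.

End Proper.

Lemma face_ideal_closed : idealr_closed face_ideal.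
Proof.
split; first exact: (@rpred0 _ (@span_pred S S^o face_rel)).
  apply/negP => /asboolP [s [sG sE]]; have := oner_neq0 K.
  rewrite -bot_eval1 sE bot_eval_sum ?eqxx // => p /sG pG.
  by rewrite [LHS]bot_evalM (bot_eval_rel pG) mulr0.
by move=> a p q pI qI; apply: (@rpredD _ (@span_pred S S^o face_rel)) => //;
  apply: (@rpredZ _ S^o (@span_pred S S^o face_rel)).
Qed.

HB.instance Definition _ := isIdealr.Build S face_ideal face_ideal_closed.

Definition face_ring := {ideal_quot face_ideal}.
HB.instance Definition _ := GRing.ComNzRing.on face_ring.

Definition face_proj (p : S) : face_ring := \pi_face_ring p.

Lemma face_projB : {morph face_proj : p q / p - q}.
Proof. by move=> p q; rewrite /face_proj !piE. Qed.
Lemma face_projM : {morph face_proj : p q / p * q}.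
Proof. by move=> p q; rewrite /face_proj !piE. Qed.

Definition face_scale (k : K) (x : face_ring) : face_ring :=
  face_proj k%:A * x.

Lemma face_proj1 : face_proj 1 = 1.
Proof. by rewrite /face_proj piE. Qed.
Lemma face_projD : {morph face_proj : p q / p + q}.
Proof. by move=> p q; rewrite /face_proj !piE. Qed.

Lemma face_scaleA (k l : K) (x : face_ring) :
  face_scale k (face_scale l x) = face_scale (k * l) x.
Proof.
rewrite /face_scale [LHS]mulrA; congr (_ * _).
rewrite -[LHS](face_projM k%:A l%:A); congr (face_proj _).
exact/esym/(rmorphM (in_alg S)).
Qed.
Lemma face_scale1 : left_id 1 face_scale.
Proof. by move=> x; rewrite /face_scale scale1r face_proj1 [LHS]mul1r. Qed.
Lemma face_scaleDr : right_distributive face_scale +%R.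
Proof. by move=> k x y; rewrite /face_scale [LHS]mulrDr. Qed.
Lemma face_scaleDl (x : face_ring) : {morph face_scale^~ x : k l / k + l}.
Proof. by move=> k l; rewrite /face_scale scalerDl (face_projD k%:A l%:A) [LHS]mulrDl. Qed.

HB.instance Definition _ := GRing.Zmodule_isLmodule.Build K face_ring
  face_scaleA face_scale1 face_scaleDr face_scaleDl.

Lemma face_scaleAl (k : K) (x y : face_ring) : k *: (x * y) = k *: x * y.
Proof. exact: mulrA. Qed.

HB.instance Definition _ := GRing.Lmodule_isLalgebra.Build K face_ring
  face_scaleAl.
HB.instance Definition _ := GRing.Lalgebra_isComAlgebra.Build K face_ring.

(* The degree of a monomial, where pvar a has degree prank a. *)
Definition monom_degree (m : {cmonom P}) : nat :=
  (\sum_(a <- finsupp m) m a * prank a)%N.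

Definition homogeneous (i : nat) : set S :=
  [set p | forall m, m \in msupp p -> monom_degree m = i].

Definition face_ring_graded (i : nat) : set face_ring :=
  face_proj @` homogeneous i.

End FaceRing.

Section FaceModule.
Variables (F : fieldType) (R : idomainType) (iota : {rmorphism R -> F}).
Variables (n : nat) (M : realizable_matroid R n) (K : fieldType).

Definition link_ring : comAlgType K := face_ring K (link iota M).

Definition face_module : lmodType link_ring :=
  'rV[link_ring]_(card_tor M finset.set0).

(* The homogeneous component of degree i, a subspace of the K-vector space
   underlying face_module. *)
Definition face_module_graded (i : nat) :
    set (restriction (in_alg link_ring) face_module) :=
  [set v | forall j, face_ring_graded i ((v : face_module) ord0 j)].

Definition hilbert_series (i : nat) : nat := vdim (face_module_graded i).

End FaceModule.

(* The rational function q is regular at 0 and h is the sequence of the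
   coefficients of its power series expansion. *)
Definition power_series_of (q : {fraction {poly int}}) (h : nat -> int) :=
  exists p e : {poly int},
    [/\ e`_0 != 0, q = tofrac p / tofrac e
      & forall i, \sum_(j < i.+1) e`_j * h (i - j)%N = p`_i].

Definition eval2 (A : comNzRingType) (T : {poly {poly int}}) (x y : A) : A :=
  (map_poly (map_poly intr) T).[x, y].

(* Main.v *)
Require Import Defs.
From HB Require Import structures.
From mathcomp Require Import all_boot all_order all_algebra all_field.
From mathcomp Require Import generic_quotient ring_quotient.
From mathcomp Require Import finmap.
From mathcomp Require Import boolp classical_sets functions cardinality fsbigop.
From mathcomp Require Import monalg ring.
From Stdlib Require Import Relation_Operators.

Set Implicit Arguments.
Unset Strict Implicit.
Unset Printing Implicit Defensive.

Import Order.TTheory GRing.Theory Num.Theory.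
Local Open Scope ring_scope.
Local Open Scope classical_set_scope.

(** Write tau for the order of the torsion of the module of the empty set.
    Both sides are equal to the sum, over the independent sets A, of
    |tor(A)^v| t^|A| / (1 - t)^|A|.

    On the Tutte side this is direct.  At y = 1 a term survives only if
    |A| <= rk A, and rk A <= |A| always holds, so exactly the independent sets
    contribute; t^r / (1 - t)^r times (1/t - 1)^(r - |A|) is
    t^|A| / (1 - t)^|A|.

    On the Hilbert side the argument has two halves.

    Algebra of the face ring.  For a simplicial poset P whose elements carry
    vertex sets (simplicial_labelling), let x_c|v be the variable of the face of
    c on the vertex v.  Inside the star of c the relations collapse: the product
    of x_c with the variables of two faces of c may be rewritten with the
    intersection and the union of the two faces (fvar_star), so x_c x_{c|D} is
    x_c times the product of the x_{c|v}, v in D.  Hence the elements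
    x_c prod_v x_{c|v}^(e v), with e supported on the vertices of c, span the
    face ring (std_mon_span).  They are independent: the face ring maps to the
    polynomial ring on the vertices by sending x_b to the product of the
    vertices of b if b <= a and to 0 otherwise, and this map, for a of minimal
    support among the terms of a relation, isolates the coefficients of the
    terms at a (chart_coef_ideal).  So the Hilbert series of the face ring is
    the sum over c of (t / (1 - t))^|c| (face_ring_graded_dim).

    Counting the link.  The order on Gr M is restriction of characters
    (gr_leP), so the elements of the link over A are the characters of tor(A)
    that vanish on tor(empty set); tor(empty set) embeds in tor(A) when A is
    independent (torsion_map_inj).  Over a PID with finite residue rings, a
    homomorphism from a submodule S of a finite torsion module T to Q(R)/R has
    exactly |T| / |S| extensions to T (card_extensions): adjoining x to S,
    the admissible values d at x solve g d = phi(g x), where g generates the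
    ideal of the a with a x in S, and Q(R)/R has |R/g| solutions because it is
    divisible with g-torsion R/g.  For S = 0 this gives |tor(A)^v| = |tor(A)|,
    and for S = tor(empty set) it gives tau times the number of elements of the
    link over A as |tor(A)^v| (card_link_fiber).

    The ring of integers enters through two facts only: its fraction field is F
    (frac_of_integers), and R/g is finite for g <> 0 (finite_residues). *)

(** * Spans and dimensions *)

Lemma span_imageP (R : pzRingType) (M : lmodType R) (I : finType) (A : {set I})
    (f : I -> M) x :
  Defs.span (f @` [set` A]) x <-> exists c : I -> R, x = \sum_(i in A) c i *: f i.
Proof.
split=> [[s [sG ->]]|[c ->]]; last first.
  exists [seq (c i, f i) | i <- enum A]; split; last by rewrite big_map big_enum.
  by move=> _ /mapP[i iA ->]; exists i => //=; rewrite mem_enum in iA.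
elim: s sG => [|p s IH] sG.
  by exists (fun=> 0); rewrite big_nil big1 // => i _; rewrite scale0r.
have [j /= jA fj] := sG p (mem_head _ _).
have [|c sE] := IH; first by move=> q qs; apply: sG; rewrite inE qs orbT.
exists (fun i => (i == j)%:R * p.1 + c i); rewrite big_cons sE.
under [RHS]eq_bigr do rewrite scalerDl.
rewrite big_split /= -fj; congr (_ + _).
rewrite (bigD1 j) //= eqxx mul1r big1 ?addr0 // => i /andP[_ /negPf->].
by rewrite mul0r scale0r.
Qed.

Lemma span_rangeP (R : pzRingType) (M : lmodType R) (I : finType) (b : I -> M) x :
  Defs.span (range b) x <-> exists c : I -> R, x = \sum_i c i *: b i.
Proof.
have -> : range b = b @` [set` [set: I]%SET].
  by congr (_ @` _); apply/seteqP; split=> i //= _; rewrite finset.in_setT.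
rewrite span_imageP; split=> -[c ->]; exists c;
  by apply: eq_bigl => i; rewrite finset.in_setT.
Qed.

Section HasDim.
Variables (K : fieldType) (V : lmodType K).
Implicit Types (U : set V).

(** A basis may be indexed by any finite set of labels, which spares a numbering
    of the standard monomials. *)
Lemma has_dim_enum U (J : finType) (D : {pred J}) (b : J -> V) :
    (forall j, j \in D -> U (b j)) ->
    (forall x, U x -> exists c : J -> K, x = \sum_(j in D) c j *: b j) ->
    (forall c : J -> K, \sum_(j in D) c j *: b j = 0 ->
       forall j, j \in D -> c j = 0) ->
  has_dim U #|D|.
Proof.
move=> bU bspan bfree; exists (b \o @enum_val J D); split=> [i|x /bspan[c ->]|c c0 i].
- exact/bU/enum_valP.
- apply/span_rangeP; exists (c \o @enum_val J D).
  by rewrite (big_enum_val (A := D) (fun j => c j *: b j)).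
have D0D := enum_valP i.
have := bfree (c \o enum_rank_in D0D) _ (enum_val i) (enum_valP i).
rewrite /= enum_valK_in; apply.
rewrite (big_enum_val (A := D) (fun j => (c \o enum_rank_in D0D) j *: b j)) -[RHS]c0.
by apply: eq_bigr => j _ /=; rewrite enum_valK_in.
Qed.

Lemma has_dim_leq U d d' : has_dim U d -> has_dim U d' -> (d <= d')%N.
Proof.
move=> [b [bU _ bfree]] [b' [_ b'span _]].
have cP i : exists c : 'I_d' -> K, b i == \sum_j c j *: b' j.
  by have /span_rangeP[c ->] := b'span _ (bU i); exists c.
have /fin_all_exists[C CE] := cP.
pose A := \matrix_(i, j) C i j.
rewrite -(eqP (_ : row_free A)) ?rank_leq_col //.
apply: inj_row_free => v vA0; apply/rowP => i; rewrite mxE.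
apply: (bfree (v 0)); under eq_bigr do rewrite (eqP (CE _)) scaler_sumr.
rewrite exchange_big big1 // => j _.
under eq_bigr do rewrite scalerA; rewrite -scaler_suml.
have /rowP/(_ j) := vA0; rewrite !mxE => vA0j.
rewrite -[X in X *: _ = _](_ : 0 = _) ?scale0r // -[LHS]vA0j.
by apply: eq_bigr => k _; rewrite mxE.
Qed.

Lemma has_dim_vdim U d : has_dim U d -> vdim U = d.
Proof.
rewrite /vdim => Ud; case: xgetP => [k _ Uk|/(_ d Ud) //].
by apply/eqP; rewrite eqn_leq !(has_dim_leq (U := U)).
Qed.

End HasDim.

(** Only one coordinate of a row at a time needs to be nonzero, so the products
    of the unit rows with a basis of U form a basis. *)
Lemma has_dim_rows (K : fieldType) (A : algType K) (U : set A) (d m : nat) :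
    U 0 -> has_dim U d ->
  has_dim ([set v | forall j, U ((v : 'rV[A]_m) ord0 j)]
             : set (restriction (in_alg A) 'rV[A]_m)) (m * d).
Proof.
move=> U0 [b [bU bspan bfree]].
rewrite (_ : (m * d)%N = #|{: 'I_m * 'I_d}|); last by rewrite card_prod !card_ord.
pose c (p : 'I_m * 'I_d) : restriction (in_alg A) 'rV[A]_m :=
  \row_j (if j == p.1 then b p.2 else 0).
have cE (C : 'I_m * 'I_d -> K) j :
    (\sum_p C p *: c p : 'rV[A]_m) ord0 j = \sum_i C (j, i) *: b i.
  rewrite [LHS]summxE.
  transitivity (\sum_k \sum_i C (k, i) *: (c (k, i) : 'rV[A]_m) ord0 j).
    rewrite pair_bigA; apply: eq_bigr => -[k i] _ /=.
    by rewrite [LHS]mxE mulr_algl.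
  rewrite (bigD1 j) //= [X in _ + X]big1 ?addr0 => [|k kj].
    by apply: eq_bigr => i _; rewrite !mxE eqxx.
  by rewrite big1 // => i _; rewrite !mxE eq_sym (negPf kj) scaler0.
apply: (has_dim_enum (b := c)) => [p _ j|v vU|C C0 [k i] _].
- by rewrite mxE; case: eqP.
- have vP j : exists C : 'I_d -> K, (v : 'rV[A]_m) ord0 j == \sum_i C i *: b i.
    by have /span_rangeP[C ->] := bspan _ (vU j); exists C.
  have /fin_all_exists[C CE] := vP.
  exists (fun p => C p.1 p.2); apply/rowP => j; rewrite (eqP (CE j)).
  exact/esym/(cE (fun p => C p.1 p.2)).
- apply: (bfree (fun i => C (k, i))); rewrite -cE.
  have := congr1 (fun v : 'rV[A]_m => v ord0 k) C0; rewrite !mxE => <-.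
  by congr (fun_of_matrix _ _ _); apply: eq_bigl => p; rewrite inE.
Qed.

(** * Simplicial posets with labelled vertices *)

(** A simplicial poset presented by the vertex set of each element and by the
    face of an element on a given set of vertices (vertices outside of the
    element are ignored).  Such a poset is a poset of simplices in which, unlike
    in a simplicial complex, several elements may have the same vertices. *)
Record simplicial_labelling (d : Order.disp_t) (P : bPOrderType d) (n : nat)
    (supp : P -> {set 'I_n}) (face : P -> {set 'I_n} -> P) : Prop := {
  supp_face : forall x S, supp (face x S) = (supp x :&: S)%SET;
  face_face : forall x S T, face (face x S) T = face x (S :&: T)%SET;
  face_supp : forall x, face x (supp x) = x;
  le_face : forall x y, (x <= y)%O <-> exists S, x = face y S
}.

Section LabelledPoset.
Variables (d : Order.disp_t) (P : bPOrderType d) (n : nat).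
Variables (supp : P -> {set 'I_n}) (face : P -> {set 'I_n} -> P).
Hypothesis lab : simplicial_labelling supp face.
Implicit Types (a b c x y : P) (S T : {set 'I_n}).

Lemma face_le x S : (face x S <= x)%O.
Proof. by apply/(le_face lab); exists S. Qed.

Lemma face_suppI x S : face x (supp x :&: S)%SET = face x S.
Proof. by rewrite -(face_face lab) (face_supp lab). Qed.

Lemma face_of_le x y : (x <= y)%O -> face y (supp x) = x.
Proof.
by move/(le_face lab) => [S ->]; rewrite (supp_face lab) face_suppI.
Qed.

Lemma supp_le x y : (x <= y)%O -> supp x \subset supp y.
Proof.
by move/(le_face lab) => [S ->]; rewrite (supp_face lab) finset.subsetIl.
Qed.

Lemma le_face2 x S T : S \subset T -> (face x S <= face x T)%O.
Proof.
move=> ST; apply/(le_face lab); exists S; rewrite (face_face lab).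
by rewrite finset.setIC (finset.setIidPl ST).
Qed.

Lemma supp_bot : supp \bot%O = finset.set0.
Proof.
apply/eqP; rewrite -finset.subset0.
have -> : \bot%O = face \bot%O finset.set0.
  by apply/le_anti; rewrite le0x face_le.
by rewrite (supp_face lab) finset.setI0.
Qed.

Lemma face0 x : face x finset.set0 = \bot%O.
Proof. by rewrite -supp_bot face_of_le ?le0x. Qed.

Lemma boolean_interval_supp x : boolean_interval x #|supp x|.
Proof.
pose v (i : 'I_#|supp x|) : 'I_n := enum_val i.
exists (fun S : {set 'I_#|supp x|} => face x [set v i | i in S]%SET); split=> [S T|y].
  apply/idP/idP => [|ST]; last exact/le_face2/imsetS.
  move=> /supp_le; rewrite !(supp_face lab) => /fintype.subsetP ST.
  apply/fintype.subsetP => i iS.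
  have := ST (v i); rewrite !inE enum_valP /= imset_f // => /(_ isT).
  by case/imsetP=> j jT /enum_val_inj ->.
split=> [yx|[S <-]]; last exact: face_le.
exists [set i | v i \in supp y]%SET; rewrite -[RHS](face_of_le yx).
congr (face x _); apply/finset.setP => u; apply/imsetP/idP => [[i]|vy].
  by rewrite inE => iy ->.
have ux := fintype.subsetP (supp_le yx) _ vy.
by exists (enum_rank_in ux u); rewrite ?inE /v enum_rankK_in.
Qed.

(** The rank of a boolean interval is well defined, since 2 ^ k is the number of
    its elements. *)
Lemma boolean_interval_card x k : boolean_interval x k -> k = #|supp x|.
Proof.
move=> [f [fle fP]]; apply/eqP.
suff : (2 ^ k == 2 ^ #|supp x|)%N by rewrite eqn_exp2l.
rewrite -[k in (2 ^ k)%N]card_ord -finset.card_powerset -finset.cardsT -finset.card_powerset.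
have f_le (S : {set 'I_k}) : (f S <= x)%O by apply/fP; exists S.
have finj : injective (fun S : {set 'I_k} => supp (f S)).
  move=> S T fST; have {}fST : f S = f T.
    by rewrite -(face_of_le (f_le S)) fST face_of_le.
  by apply/eqP; rewrite finset.eqEsubset -!fle fST lexx.
rewrite -(card_imset _ finj); apply/eqP/eq_card => T; rewrite inE.
apply/imsetP/idP => [[S _ ->]|Tx]; first exact: supp_le.
have [S fS] := (fP (face x T)).1 (face_le x T).
exists S; first by rewrite inE finset.subsetT.
by rewrite fS (supp_face lab) finset.setIC (finset.setIidPl Tx).
Qed.

Lemma prank_supp x : prank x = #|supp x|.
Proof.
rewrite /prank; case: xgetP => [k _ /boolean_interval_card //|].
by move/(_ _ (boolean_interval_supp x)).
Qed.

Lemma is_meet_face x S T : is_meet (face x S) (face x T) (face x (S :&: T)%SET).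
Proof.
split=> [||y yS yT]; rewrite ?le_face2 ?finset.subsetIl ?finset.subsetIr //.
have yx := le_trans yS (face_le x S).
rewrite -(face_of_le yx) le_face2 //; apply/finset.subsetIP.
by split; [have := supp_le yS|have := supp_le yT];
  rewrite (supp_face lab) finset.subsetI => /andP[].
Qed.

Lemma mub_face x S T : min_upper_bounds (face x S) (face x T) (face x (S :|: T)%SET).
Proof.
split; rewrite ?le_face2 ?finset.subsetUl ?finset.subsetUr // => y Sy Ty yU.
rewrite -(face_of_le yU) (face_face lab) -face_suppI.
rewrite -[RHS]face_suppI; congr (face x _).
have := supp_le Sy; have := supp_le Ty; have := supp_le yU.
rewrite !(supp_face lab) => yU' Ty' Sy'.
rewrite finset.setIA; apply/eqP; rewrite finset.eqEsubset finset.subsetIl /=.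
rewrite finset.subsetI subxx /= finset.setIUr finset.subUset.
by rewrite Sy' Ty'.
Qed.

(** An upper bound may be cut down to the vertices of a and b. *)
Lemma mub_supp a b c : min_upper_bounds a b c -> supp c = (supp a :|: supp b)%SET.
Proof.
move=> [ac bc cmin].
have aU : (a <= face c (supp a :|: supp b)%SET)%O.
  by rewrite -{1}(face_of_le ac) le_face2 ?finset.subsetUl.
have bU : (b <= face c (supp a :|: supp b)%SET)%O.
  by rewrite -{1}(face_of_le bc) le_face2 ?finset.subsetUr.
rewrite -{1}(cmin _ aU bU (face_le _ _)) (supp_face lab).
by apply/finset.setIidPr; rewrite finset.subUset !supp_le.
Qed.

(** In the boolean interval below x the join is unique; this is what makes all
    but one of the terms of a face relation vanish in the star of x. *)
Lemma mub_below a b c x : min_upper_bounds a b c -> (c <= x)%O ->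
  c = face x (supp a :|: supp b)%SET.
Proof. by move=> abc cx; rewrite -(mub_supp abc) face_of_le. Qed.

End LabelledPoset.

(** * The face ring *)

(** Locked, to keep unification away from the representation of monomials. *)
HB.lock Definition term (K : fieldType) (P : choiceType) (k : K) (m : {cmonom P}) :
  {malg K[{cmonom P}]} := << k *g m >>.

Section Terms.
Variables (K : fieldType) (P : choiceType).
Implicit Types (k : K) (m : {cmonom P}) (p : {malg K[{cmonom P}]}).

Lemma term_sum p : p = \sum_(m <- msupp p) term p@_m m.
Proof. by rewrite [LHS]monalgE; apply: eq_bigr => m _; rewrite term.unlock. Qed.

Lemma termM k k' m m' : term k m * term k' m' = term (k * k') (mmul m m').
Proof. by rewrite term.unlock; exact: fgmulUU. Qed.

Lemma termZ k m : term k m = k *: term 1 m.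
Proof.
transitivity (term k mone * term 1 m); first by rewrite termM (mulr1 k) (mul1m m).
by rewrite term.unlock; exact: mul_malgC.
Qed.

Lemma term1 : term 1 (mone : {cmonom P}) = 1 :> {malg K[{cmonom P}]}.
Proof. by rewrite term.unlock. Qed.

Lemma msupp_term k m m' : m' \in msupp (term k m) -> m' = m.
Proof.
by rewrite term.unlock => /(fsubsetP msuppU_le); rewrite inE => /eqP.
Qed.

Lemma pvar_term (a : P) : pvar K a = term 1 (ucm a).
Proof. by rewrite term.unlock pvar.unlock. Qed.

End Terms.

Section FaceProj.
Variables (K : fieldType) (d : Order.disp_t) (P : bPOrderType d).
Local Notation S := {malg K[{cmonom P}]}.
Local Notation A := (face_ring K P).
Local Notation proj := (@face_proj K d P).

Lemma face_proj_scalable (k : K) (p : S) : proj (k *: p) = k *: proj p.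
Proof. by rewrite -[k *: p]mulr_algl face_projM. Qed.

HB.instance Definition _ := GRing.isZmodMorphism.Build S A proj (@face_projB K d P).
HB.instance Definition _ := GRing.isMonoidMorphism.Build S A proj
  (@face_proj1 K d P, @face_projM K d P).
HB.instance Definition _ := GRing.isScalable.Build K S A *:%R proj face_proj_scalable.

Lemma face_proj_eq0 (p : S) : proj p = 0 <-> @Defs.span S S^o (@face_rel K d P) p.
Proof.
rewrite -(raddf0 proj); split=> [/eqP|pG].
  by rewrite /face_proj /= -Quotient.idealrBE subr0 => /asboolP.
by apply/eqP; rewrite /face_proj /= -Quotient.idealrBE subr0; apply/asboolP.
Qed.

Definition fvar (a : P) : A := proj (pvar K a).

Lemma fvar_bot : fvar \bot%O = 1.
Proof.
apply/eqP; rewrite -subr_eq0 -[X in _ - X](rmorph1 proj) -rmorphB; apply/eqP.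
apply/face_proj_eq0; exists [:: (1, pvar K \bot%O - 1)]; split.
  by move=> p; rewrite inE => /eqP-> /=; left.
by rewrite big_seq1 /= [RHS]mul1r.
Qed.

Lemma fvarM (a b : P) : fvar a * fvar b =
  proj (meet_var K a b) * proj (\sum_(c \in min_upper_bounds a b) pvar K c).
Proof.
apply/eqP; rewrite -subr_eq0 -!rmorphM -rmorphB; apply/eqP/face_proj_eq0.
eexists [:: (1, _)]; split; last by rewrite big_seq1 /= [RHS]mul1r.
by move=> p; rewrite inE => /eqP-> /=; right; exists a, b.
Qed.

End FaceProj.

Section MonomWeight.
Variables (P : choiceType) (g : P -> nat).
Implicit Types (m : {cmonom P}) (s : seq P).

(** The degree of a monomial, its content at a vertex and the number of its
    factors that do not lie below a given element are all weights. *)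
Definition monom_weight m : nat := (\sum_(a <- finsupp m) m a * g a)%N.

Lemma monom_weightEw m (D : {fset P}) : (finsupp m `<=` D)%fset ->
  monom_weight m = (\sum_(a <- D) m a * g a)%N.
Proof.
move=> mD; rewrite /monom_weight (big_fset_incl _ mD) // => a _.
by rewrite -cmE_neq0 negbK => /eqP->.
Qed.

Lemma monom_weight1 : monom_weight mone = 0%N.
Proof. by rewrite /monom_weight mdom1 big_seq_fset0. Qed.

Lemma monom_weightU a : monom_weight (ucm a) = g a.
Proof. by rewrite /monom_weight mdomU big_seq_fset1 cmUU mul1n. Qed.

Lemma monom_weightM m m' :
  monom_weight (mmul m m') = (monom_weight m + monom_weight m')%N.
Proof.
rewrite /monom_weight [in LHS]mdomD -/(monom_weight m) -/(monom_weight m').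
rewrite (monom_weightEw (fsubsetUl _ (finsupp m'))).
rewrite (monom_weightEw (fsubsetUr (finsupp m) _)) -big_split /=.
by apply: eq_bigr => a _; rewrite cmM mulnDl.
Qed.

Definition seq_monom s : {cmonom P} := \big[mmul/mone]_(a <- s) ucm a.

Lemma monom_weight_seq s : monom_weight (seq_monom s) = \sum_(a <- s) g a.
Proof.
elim: s => [|a s IH]; first by rewrite /seq_monom !big_nil monom_weight1.
by rewrite /seq_monom !big_cons monom_weightM monom_weightU -IH.
Qed.

Lemma seq_monomP m : exists s, m = seq_monom s.
Proof.
move: {2}(mdeg m) (erefl (mdeg m)) => k; elim: k m => [|k IH] m mk.
  by exists [::]; rewrite /seq_monom big_nil (mdeg_eq0I mk).
have [m1|[a am]] := fset_0Vmem (finsupp m).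
  by move: mk; rewrite mdegE m1 big_seq_fset0.
pose m' := divcm m (ucm a); have mE : m = mmul (ucm a) m'.
  apply/eqP/cmP => b; rewrite cmM divcmE cmU subnKC //.
  by case: eqP => // <-; rewrite lt0n cmE_neq0.
have [|s m's] := IH m'.
  by apply/eqP; rewrite -eqSS -mk mE mdegM mdegU add1n.
by exists (a :: s); rewrite /seq_monom big_cons mE; congr mmul.
Qed.

End MonomWeight.

(** Evaluation at the chart of x sends x_b to the product of the vertices of b
    if b <= x, and to 0 otherwise.  The boolean says that the image of the
    monomial m is nonzero and has exponents f. *)
Definition chart_mon (d : Order.disp_t) (P : bPOrderType d) (n : nat)
    (supp : P -> {set 'I_n}) (x : P) (f : {ffun 'I_n -> nat}) (m : {cmonom P}) : bool :=
  (monom_weight (fun a => ~~ (a <= x)%O : nat) m == 0%N) &&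
  [forall v, monom_weight (fun a => (v \in supp a) : nat) m == f v].

(** The coefficient of the monomial with exponents f in the chart of x.  The
    functional is used in place of the ring morphism to polynomials, since only
    coefficients are ever read off. *)
HB.lock Definition chart_coef (K : fieldType) (d : Order.disp_t)
    (P : bPOrderType d) (n : nat) (supp : P -> {set 'I_n}) (x : P)
    (f : {ffun 'I_n -> nat}) : {malg K[{cmonom P}]} -> K :=
  mmap idfun (fun m => (chart_mon supp x f m)%:R).

Section FaceRingBasis.
Variables (K : fieldType) (d : Order.disp_t) (P : bPOrderType d) (n : nat).
Variables (supp : P -> {set 'I_n}) (face : P -> {set 'I_n} -> P).
Hypothesis lab : simplicial_labelling supp face.
Variable PF : {fset P}.
Hypothesis inPF : forall x, x \in PF.
Local Notation S := {malg K[{cmonom P}]}.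
Local Notation A := (face_ring K P).
Local Notation proj := (@face_proj K d P).
Local Notation X := (@fvar K d P).
Local Notation mub := (@min_upper_bounds d P).
Implicit Types (a b c x : P) (m : {cmonom P}).

Lemma finite_subposet (B : set P) : finite_set B.
Proof.
by apply: sub_finite_set (finite_fset PF) => x _; apply: inPF.
Qed.

Lemma mub_sumE (V : nmodType) a b (f : P -> V) :
  \sum_(c \in mub a b) f c = \sum_(c <- fset_set (mub a b)) f c.
Proof. by rewrite fsbig_finite //; apply: finite_subposet. Qed.

Lemma mem_mub a b c : (c \in fset_set (mub a b)) = `[< mub a b c >].
Proof.
by rewrite in_fset_set; [rewrite /in_mem|apply: finite_subposet].
Qed.

Lemma meet_varE a b c : mub a b c ->
  meet_var K a b = pvar K (face c (supp a :&: supp b)%SET).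
Proof.
move=> [ac bc _]; have := is_meet_face lab c (supp a) (supp b).
rewrite (face_of_le lab ac) (face_of_le lab bc) /meet_var => mt.
case: asboolP => [_|[]]; last by exists (face c (supp a :&: supp b)%SET).
congr pvar; case: xgetP => [y _ [ya yb ymax]|/(_ _ mt) //].
by case: mt => ma mb mmax; apply/le_anti; rewrite ymax ?mmax.
Qed.

Lemma fvarM_mub a b c : mub a b c ->
  X a * X b = X (face c (supp a :&: supp b)%SET)
              * \sum_(z <- fset_set (mub a b)) X z.
Proof. by move=> abc; rewrite fvarM (meet_varE abc) mub_sumE raddf_sum. Qed.

Lemma fvarM_eq0 a b : (forall c, ~ mub a b c) -> X a * X b = 0.
Proof.
move=> ab0; rewrite fvarM mub_sumE big1_seq ?raddf0 ?mulr0 // => c /andP[_].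
by rewrite mem_mub => /asboolP/ab0.
Qed.

(** In the star of c, that is after multiplication by x_c, the two faces have
    only one minimal upper bound that counts: another one, z, has no upper bound
    in common with c, and then x_c x_z = 0. *)
Lemma fvar_star c (U V : {set 'I_n}) :
  X c * (X (face c U) * X (face c V)) =
  X c * (X (face c (U :&: V)%SET) * X (face c (U :|: V)%SET)).
Proof.
have cUV := mub_face lab c U V.
rewrite (fvarM_mub cUV) (face_face lab) -(face_suppI lab).
rewrite (_ : supp c :&: _ = supp c :&: (U :&: V))%SET; last first.
  apply/finset.setP => v; rewrite !(supp_face lab) !inE.
  by case: (v \in supp c); case: (v \in U); case: (v \in V).
rewrite (face_suppI lab).
rewrite mulrCA [RHS]mulrCA; congr (_ * _).
rewrite (big_fsetD1 (face c (U :|: V)%SET)) ?mem_mub; last exact/asboolP.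
rewrite mulrDr mulr_sumr big1_seq ?addr0 // => z /andP[_].
rewrite !inE mem_mub => /andP[/eqP zneq /asboolP zmub].
apply: fvarM_eq0 => y [cy zy _]; apply: zneq.
have Uy := le_trans (face_le lab c (U :|: V)%SET) cy.
rewrite (mub_below lab zmub zy) -[RHS](face_of_le lab Uy).
by congr face; rewrite !(supp_face lab) finset.setIUr.
Qed.

Lemma fvar_star_seq c (s : seq 'I_n) : uniq s ->
  X c * \prod_(v <- s) X (face c [set v]%SET) = X c * X (face c [set:: s]%SET).
Proof.
elim: s => [_|v s IH /andP[vs /IH sE]].
  by rewrite big_nil finset.set_nil (face0 lab) fvar_bot.
rewrite big_cons mulrCA sE mulrCA fvar_star finset.set_cons.
rewrite (_ : _ :&: _ = finset.set0)%SET ?(face0 lab) ?fvar_bot ?mul1r //.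
apply/finset.setP => u; rewrite !inE; case: eqP => //= ->.
exact/negbTE.
Qed.

(** In the star of c, the variable of a face is the product of its vertices;
    for the face c itself this rewrites the square of x_c. *)
Lemma fvar_star_set c (U : {set 'I_n}) :
  X c * \prod_(v in U) X (face c [set v]%SET) = X c * X (face c U).
Proof.
by rewrite -big_enum fvar_star_seq ?enum_uniq // finset.set_enum.
Qed.

Definition std_mon c (e : {ffun 'I_n -> nat}) : A :=
  X c * \prod_v X (face c [set v]%SET) ^+ e v.

Definition std_exp c (e : {ffun 'I_n -> nat}) : bool :=
  [forall v, (v \notin supp c) ==> (e v == 0%N)].

Definition add_exp (U : {set 'I_n}) (e : {ffun 'I_n -> nat}) : {ffun 'I_n -> nat} :=
  [ffun v => ((v \in U) + e v)%N].

(** Multiplying by x_b distributes over the minimal upper bounds c of a and b;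
    the vertices of a meet b come out of the variable of the meet. *)
Lemma fvar_std_mon b a e : std_exp a e ->
  X b * std_mon a e = \sum_(c <- fset_set (mub a b))
     std_mon c (add_exp (supp a :&: supp b)%SET e).
Proof.
move=> /forallP ea; have [[z abz]|abN] := pselect (exists z, mub a b z); last first.
  have ab0 c : ~ mub a b c by move=> abc; apply: abN; exists c.
  rewrite /std_mon mulrA (mulrC (X b)) (fvarM_eq0 ab0) mul0r big1_seq // => c.
  by rewrite mem_mub => /andP[_ /asboolP/ab0].
rewrite /std_mon mulrA (mulrC (X b)) fvarM mub_sumE raddf_sum mulr_sumr mulr_suml.
apply: eq_big_seq => c; rewrite mem_mub => /asboolP abc.
rewrite (meet_varE abc) -!/(fvar _ _) (mulrC _ (X c)) -fvar_star_set -mulrA.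
congr (_ * _); rewrite big_mkcond -big_split /=; apply: eq_bigr => v _.
rewrite ffunE exprD; have [ac bc _] := abc; congr (_ * _).
  by case: (v \in _)%SET.
have := implyP (ea v); have [va _|va /(_ isT)/eqP->//] := boolP (v \in supp a).
rewrite -[in LHS](face_of_le lab ac) (face_face lab) (_ : (_ :&: _)%SET = [set v]%SET) //.
by apply/finset.setIidPr; rewrite finset.sub1set.
Qed.

(** Straightening: every monomial is a sum of standard monomials of the same
    degree, since #|A :|: B| + #|A :&: B| = #|A| + #|B|. *)
Lemma std_mon_span (s : seq P) : exists t : seq (P * {ffun 'I_n -> nat}),
  (forall p, p \in t -> std_exp p.1 p.2 /\
     (#|supp p.1| + \sum_v p.2 v = \sum_(a <- s) #|supp a|)%N) /\
  \prod_(a <- s) X a = \sum_(p <- t) std_mon p.1 p.2.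
Proof.
elim: s => [|b s [t [tP sE]]].
  exists [:: (\bot%O, [ffun=> 0%N])]; split.
    move=> p; rewrite inE => /eqP-> /=; split.
      by apply/forallP => v; rewrite ffunE eqxx implybT.
    by rewrite big_nil (supp_bot lab) cards0 big1 // => v _; rewrite ffunE.
  rewrite big_nil big_seq1 /std_mon fvar_bot mul1r big1 // => v _.
  by rewrite ffunE.
exists (flatten [seq [seq (c, add_exp (supp p.1 :&: supp b)%SET p.2)
     | c <- fset_set (mub p.1 b)] | p <- t]); split; last first.
  rewrite big_cons sE mulr_sumr big_flatten big_map /=.
  by apply: eq_big_seq => p /tP[pe _]; rewrite fvar_std_mon // big_map.
move=> q /flattenP[l /mapP[p /tP[/forallP pe pdeg]] ->].
move=> /mapP[c]; rewrite mem_mub => /asboolP abc ->.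
have cE := mub_supp lab abc; split=> /=.
  apply/forallP => v; apply/implyP; rewrite ffunE cE !inE negb_or => /andP[va _].
  by rewrite (negPf va) /=; apply: (implyP (pe v)).
under eq_bigr do rewrite ffunE.
rewrite big_split /= big_cons -pdeg !addnA cE; congr (_ + _)%N.
rewrite (addnC #|supp b|) -cardsUI; congr (_ + _)%N.
by rewrite -sum1_card [RHS]big_mkcond; apply: eq_bigr => v _; case: (v \in _)%SET.
Qed.

Local Notation chart_mon := (chart_mon supp).
Local Notation chart_coef := (@chart_coef K d P n supp).

Lemma chart_coef_additive x f : {morph chart_coef x f : p q / p - q}.
Proof. by rewrite chart_coef.unlock; exact: mmap_is_additive. Qed.

HB.instance Definition _ x f :=
  GRing.isZmodMorphism.Build S K (chart_coef x f) (chart_coef_additive x f).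

Lemma chart_coef_sum x f (I : eqType) (r : seq I) (F : I -> S) :
  chart_coef x f (\sum_(i <- r) F i) = \sum_(i <- r) chart_coef x f (F i).
Proof. exact: raddf_sum. Qed.

Lemma chart_coef_mulB x f (p q q' : S) :
  chart_coef x f (p * (q - q')) = chart_coef x f (p * q) - chart_coef x f (p * q').
Proof. by rewrite mulrBr chart_coef_additive. Qed.

Lemma chart_coef_sumM x f (I : eqType) (r : seq I) (F : I -> S) (p q : S) :
  chart_coef x f (p * (q * \sum_(i <- r) F i)) =
  \sum_(i <- r) chart_coef x f (p * (q * F i)).
Proof. by rewrite -chart_coef_sum -!mulr_sumr. Qed.

Lemma chart_coef_mul0 x f (q : S) :
    (forall k m, chart_coef x f (term k m * q) = 0) ->
  forall p : S, chart_coef x f (p * q) = 0.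
Proof.
move=> q0 p; rewrite [p]term_sum mulr_suml chart_coef_sum big1 // => m _.
Qed.

Lemma chart_coef_term x f k m : chart_coef x f (term k m) = k * (chart_mon x f m)%:R.
Proof. by rewrite chart_coef.unlock term.unlock; exact: mmapU. Qed.

Lemma chart_mon_above x f m m' c : ~~ (c <= x)%O ->
  chart_mon x f (mmul m (mmul m' (ucm c))) = false.
Proof.
move=> cx; rewrite /chart_mon !monom_weightM monom_weightU cx.
by rewrite addnA addn1.
Qed.

(** The chart of x respects the face relations: if a and b lie below x, exactly
    one minimal upper bound does, and intersection plus union of vertex sets
    have the content of the two sets; otherwise both sides vanish. *)
Lemma chart_coef_rel x f p q : @face_rel K d P q -> chart_coef x f (p * q) = 0.
Proof.
move=> qrel; move: p; apply: chart_coef_mul0 => k m.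
case: qrel => [{q}->|[a [b {q}->]]]; rewrite chart_coef_mulB !pvar_term.
  rewrite -[in X in _ - X]term1 !termM !(mulr1 k) (mulm1 m) !chart_coef_term; apply/eqP; rewrite subr_eq0.
  apply/eqP; congr (_ * (nat_of_bool _)%:R).
  rewrite /chart_mon monom_weightM monom_weightU le0x addn0; congr (_ && _).
  apply: eq_forallb => v; rewrite monom_weightM monom_weightU (supp_bot lab).
  by rewrite inE addn0.
rewrite mub_sumE (termM 1 1) (mulr1 (1 : K)) (termM k 1) (mulr1 k) (chart_coef_sumM x f).
apply/eqP; rewrite subr_eq0; apply/eqP.
have above (q : S) c : ~~ (c <= x)%O -> chart_coef x f (term k m * (q * pvar K c)) = 0.
  move=> cx; rewrite mulrCA; move: q; apply: chart_coef_mul0 => k' m'.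
  by rewrite pvar_term !termM chart_coef_term chart_mon_above ?mulr0.
have [ax|ax] := boolP (a <= x)%O; last first.
  rewrite (mulmC (ucm a)) chart_coef_term chart_mon_above // mulr0 big1_seq // => c.
  rewrite mem_mub => /andP[_ /asboolP[ac _ _]]; apply: above.
  by apply: contra ax => /(le_trans ac).
have [bx|bx] := boolP (b <= x)%O; last first.
  rewrite chart_coef_term chart_mon_above // mulr0 big1_seq // => c.
  rewrite mem_mub => /andP[_ /asboolP[_ bc _]]; apply: above.
  by apply: contra bx => /(le_trans bc).
have := mub_face lab x (supp a) (supp b).
rewrite (face_of_le lab ax) (face_of_le lab bx).
set c := face x _ => abc.
rewrite (big_fsetD1 c) ?mem_mub ?big1_seq ?addr0; first last.
- exact/asboolP.
- move=> z /andP[_]; rewrite !inE mem_mub => /andP[zc /asboolP abz].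
  by apply: above; apply: contra zc => zx; rewrite (mub_below lab abz zx).
rewrite (meet_varE abc) !pvar_term !termM !(mulr1 k, mulr1 (1 : K)) !chart_coef_term.
rewrite [RHS]addr0; congr (_ * (nat_of_bool _)%:R); rewrite /chart_mon.
have cx : (c <= x)%O := face_le lab _ _.
rewrite !monom_weightM !monom_weightU ax bx cx.
rewrite (le_trans (face_le lab _ _) cx) !addn0; congr (_ && _).
apply: eq_forallb => v; rewrite !monom_weightM !monom_weightU (mub_supp lab abc).
rewrite (supp_face lab) (mub_supp lab abc) !inE.
by case: (v \in supp a); case: (v \in supp b).
Qed.

Lemma chart_coef_ideal x f p : proj p = 0 -> chart_coef x f p = 0.
Proof.
move=> /face_proj_eq0[s [sG ->]]; rewrite chart_coef_sum big1_seq // => q /andP[_ qs].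
exact/chart_coef_rel/sG.
Qed.

Lemma proj_seq_monom (s : seq P) :
  proj (term 1 (seq_monom s)) = \prod_(a <- s) X a.
Proof.
elim: s => [|a s IH]; rewrite /seq_monom ?big_nil ?big_cons.
  by rewrite term1 rmorph1.
by rewrite -IH /fvar -rmorphM pvar_term termM (mulr1 (1 : K)).
Qed.

(** The standard monomial as a list of variables, on which weights are sums. *)
Definition std_seq c (e : {ffun 'I_n -> nat}) : seq P :=
  c :: flatten [seq nseq (e v) (face c [set v]%SET) | v <- index_enum 'I_n].

Lemma std_monE c e :
  std_mon c e = proj (term 1 (seq_monom (std_seq c e))).
Proof.
rewrite proj_seq_monom big_cons big_flatten big_map; congr (_ * _).
by apply: eq_bigr => v _; rewrite big_nseq iter_mulr_1.
Qed.

Lemma std_seq_weight g c e : monom_weight g (seq_monom (std_seq c e)) =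
  (g c + \sum_v e v * g (face c [set v]%SET))%N.
Proof.
rewrite monom_weight_seq big_cons big_flatten big_map; congr (_ + _)%N.
by apply: eq_bigr => v _; rewrite big_nseq iter_addn_0 mulnC.
Qed.

Lemma std_seq_degree c e : std_exp c e ->
  monom_degree (seq_monom (std_seq c e)) = (#|supp c| + \sum_v e v)%N.
Proof.
move=> /forallP ce; rewrite -[LHS]/(monom_weight _ _) std_seq_weight.
rewrite (prank_supp lab); congr (_ + _)%N; apply: eq_bigr => v _.
rewrite (prank_supp lab) (supp_face lab).
have := implyP (ce v); have [vc _|_ /(_ isT)/eqP-> //] := boolP (v \in supp c).
rewrite (_ : _ :&: _ = [set v])%SET ?cards1 ?muln1 //.
by apply/finset.setIidPr; rewrite finset.sub1set.
Qed.

Lemma chart_std_seq x f c e : std_exp c e ->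
  chart_mon x f (seq_monom (std_seq c e)) =
  (c <= x)%O && [forall v, ((v \in supp c) + e v)%N == f v].
Proof.
move=> /forallP ce; rewrite /chart_mon std_seq_weight addn_eq0 eqb0 negbK.
have [cx|//] := boolP (c <= x)%O; rewrite big1 ?eqxx => [/=|v _]; last first.
  by rewrite (le_trans (face_le lab _ _) cx) muln0.
apply: eq_forallb => v; rewrite std_seq_weight; congr ((_ + _)%N == _).
rewrite (bigD1 v) //= big1 => [|u uv]; last first.
  by rewrite (supp_face lab) !inE eq_sym (negPf uv) andbF muln0.
rewrite (supp_face lab) !inE eqxx andbT addn0.
have := implyP (ce v); have [vc _|_ /(_ isT)/eqP->] := boolP (v \in supp c).
  by rewrite muln1.
by rewrite mul0n.
Qed.

Lemma proj_term k m : proj (term k m) = k *: proj (term 1 m).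
Proof. by rewrite termZ linearZ. Qed.

Lemma proj_term_span m : exists t : seq (P * {ffun 'I_n -> nat}),
  (forall p, p \in t -> std_exp p.1 p.2 /\
     (#|supp p.1| + \sum_v p.2 v = monom_degree m)%N) /\
  proj (term 1 m) = \sum_(p <- t) std_mon p.1 p.2.
Proof.
have [s ->] := seq_monomP m; have [t [tP sE]] := std_mon_span s.
exists t; split; last by rewrite proj_seq_monom.
move=> p /tP[pe ->]; split=> //; rewrite -[RHS]/(monom_weight _ _).
by rewrite monom_weight_seq; apply: eq_bigr => a _; rewrite (prank_supp lab).
Qed.

Variable N : nat.

(** Labels of standard monomials with exponents below N.  In degree i any bound
    N > i catches all of them; it is left free so that one N serves all degrees
    up to a given one. *)
Definition std_index : Type := PF * {ffun 'I_n -> 'I_N}.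
HB.instance Definition _ := Finite.on std_index.

Definition index_exp (j : std_index) : {ffun 'I_n -> nat} :=
  [ffun v => (j.2 v : nat)].

Definition index_elt (j : std_index) : P := val j.1.

Definition index_deg i : {pred std_index} := [pred j |
  std_exp (index_elt j) (index_exp j) &&
  (#|supp (index_elt j)| + \sum_v index_exp j v == i)%N].

Lemma face_ring_graded_dim i : (i < N)%N ->
  has_dim (@face_ring_graded K d P i) #|index_deg i|.
Proof.
move=> iN; pose b j := std_mon (index_elt j) (index_exp j).
have bE k j : k *: b j = proj (term k (seq_monom (std_seq (index_elt j) (index_exp j)))).
  by rewrite proj_term -std_monE.
apply: (has_dim_enum (b := b)) => [j /andP[je /eqP jdeg]|_ [p pdeg <-]|c c0 j jD].
- rewrite /b std_monE.
  exists (term 1 (seq_monom (std_seq (index_elt j) (index_exp j)))) => // m.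
  by move=> /msupp_term->; rewrite std_seq_degree.
- pose spanned y := exists c : std_index -> K, y = \sum_(j in index_deg i) c j *: b j.
  have spanned0 : spanned 0.
    by exists (fun=> 0); rewrite big1 // => j _; rewrite scale0r.
  have spannedD y z : spanned y -> spanned z -> spanned (y + z).
    move=> [c ->] [c' ->]; exists (fun j => c j + c' j); rewrite -big_split /=.
    by apply: eq_bigr => j _; rewrite scalerDl.
  have spannedZ k y : spanned y -> spanned (k *: y).
    move=> [c ->]; exists (fun j => k * c j); rewrite scaler_sumr.
    by apply: eq_bigr => j _; rewrite scalerA.
  have spanned_std a e : std_exp a e -> (#|supp a| + \sum_v e v = i)%N ->
      spanned (std_mon a e).
    move=> ae deg; have eN v : (e v < N)%N.
      apply: leq_ltn_trans iN; rewrite -deg (bigD1 v) //= addnCA.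
      exact: leq_addr.
    pose j : std_index := ([` inPF a]%fset, [ffun v => Ordinal (eN v)]).
    have jE : index_exp j = e by apply/ffunP => v; rewrite !ffunE.
    have jD : j \in index_deg i by rewrite inE jE ae deg eqxx.
    exists (fun k => (k == j)%:R); rewrite (bigD1 j) //= eqxx scale1r big1 ?addr0.
      by rewrite /b jE.
    by move=> k /andP[_ /negPf->]; rewrite scale0r.
  rewrite [p]term_sum raddf_sum big_seq.
  elim/big_rec: _ => [|m y mp]; first exact: spanned0.
  apply: (spannedD); rewrite /= proj_term; apply: (spannedZ).
  have [t [tP ->]] := proj_term_span m; rewrite big_seq.
  elim/big_rec: _ => [|q z /tP[qe qdeg]]; first exact: spanned0.
  by apply: (spannedD); apply: (spanned_std); rewrite // qdeg pdeg.
- apply/eqP/negPn/negP => cj.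
  (* at an element of minimal support the chart kills the terms not above it *)
  pose Q := [pred j | (j \in index_deg i) && (c j != 0)].
  have Qj : Q j by rewrite /= jD.
  case: (arg_minnP (fun j => #|supp (index_elt j)|) Qj) => j0 /andP[j0D cj0] j0min.
  case/negP: cj0; move: c0; under eq_bigr do rewrite bE.
  rewrite -raddf_sum => /(@chart_coef_ideal (index_elt j0)
     [ffun v => (v \in supp (index_elt j0)) + index_exp j0 v]%N).
  rewrite -big_enum chart_coef_sum big_enum (bigD1 j0) //= big1 => [|j1 /andP[j1D j1j0]].
    have /andP[j0e _] := j0D; rewrite addr0 chart_coef_term chart_std_seq // lexx /=.
    rewrite (_ : [forall v, _] = true) ?mulr1 // => [->//|].
    by apply/forallP => v; rewrite !ffunE.
  rewrite chart_coef_term; have /andP[j1e _] := j1D; rewrite chart_std_seq //.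
  have [le10|] := boolP (index_elt j1 <= index_elt j0)%O; last by rewrite mulr0.
  have [-> | cj1] := eqVneq (c j1) 0; first by rewrite mul0r.
  have supp10 : supp (index_elt j1) = supp (index_elt j0).
    by apply/eqP; rewrite eqEcard (supp_le lab le10) j0min //= j1D.
  have elt10 : index_elt j1 = index_elt j0.
    by rewrite -(face_of_le lab le10) supp10 (face_supp lab).
  rewrite (_ : [forall v, _] = false) ?mulr0 //.
  apply: contraNF j1j0 => /forallP e10; apply/eqP.
  rewrite [j1]surjective_pairing [j0]surjective_pairing; congr pair.
    exact: val_inj.
  apply/ffunP => v; apply: val_inj; have := e10 v.
  by rewrite !ffunE elt10 eqn_add2l => /eqP.
Qed.

End FaceRingBasis.

(** * Rings of integers *)
Definition divides (R : pzRingType) (g x : R) := exists c, x = c * g.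

Lemma common_denominator (I : finType) (f : I -> rat) :
  exists2 D : int, D != 0 & forall i, exists z : int, D%:~R * f i == z%:~R.
Proof.
exists (\prod_i denq (f i)).
  by rewrite prodf_seq_neq0; apply/allP => i _; rewrite denq_neq0.
move=> i; exists ((\prod_(j | j != i) denq (f j)) * numq (f i)).
rewrite (bigD1 i) //= mulrC !rmorphM /= -[X in X * _]divq_num_den.
by rewrite mulrA divfK ?intq_eq0 ?denq_neq0 // mulrC.
Qed.

Section RingOfIntegers.
Variables (F : fieldExtType rat) (R : idomainType) (iota : {rmorphism R -> F}).
Hypothesis R_int : ring_of_integers iota.

Lemma iota_inj : injective iota. Proof. by case: R_int. Qed.

Lemma intr_ext_eq0 (V : nzRingType) (f : {rmorphism V -> F}) (m : int) :
  m%:~R = 0 :> V -> m = 0.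
Proof.
move=> m0; have : m%:~R = 0 :> F by rewrite -(rmorph_int f) m0 rmorph0.
rewrite -(rmorph_int (in_alg F)) /= => /eqP.
by rewrite scaler_eq0 oner_eq0 orbF intr_eq0 => /eqP.
Qed.

Lemma algebraic_int (x : F) : exists2 q : {poly int},
  q != 0 & root (map_poly intr q) x.
Proof.
have /polyOver1P[p pE] := minPolyOver 1%AS x.
have [q [a a0 qE]] := rat_poly_scale p.
have p0 : p != 0.
  by apply: contraTneq (monic_minPoly 1%AS x) => p0; rewrite pE p0 rmorph0 monicE lead_coef0 eq_sym oner_eq0.
exists q; first by apply: contraNneq p0 => q0; rewrite qE q0 rmorph0 scaler0.
have := root_minPoly 1%AS x; rewrite pE qE map_polyZ rootZ ?fmorph_eq0 ?invr_eq0 ?intr_eq0 //.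
by rewrite -map_poly_comp; congr root; apply: eq_map_poly => i; apply: (rmorph_int (in_alg F)).
Qed.

(** If m is the leading coefficient of an integer polynomial q of degree e + 1
    with root x, then m x is a root of m ^ e q (X / m), which is monic. *)
Lemma clear_denominator (x : F) : exists2 m : int,
  m != 0 & exists a, iota a = m%:~R * x.
Proof.
have [q q0 qx] := algebraic_int x.
exists (lead_coef q); first by rewrite lead_coef_eq0.
suff : integralOver (intr : int -> F) ((lead_coef q)%:~R * x).
  by move/(R_int.2) => [a ->]; exists a.
set m := lead_coef q; have szq : (1 < size q)%N.
  rewrite ltnNge; apply/negP => /size1_polyC qE; move: qx q0.
  rewrite qE map_polyC rootC /= => /eqP/(intr_ext_eq0 (idfun : {rmorphism F -> F}))->.
  by rewrite eqxx.
pose e := (size q).-2; have szE : size q = e.+2 by rewrite /e -subn2 -addn2 subnK.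
exists ('X^(e.+1) + \poly_(i < e.+1) (q`_i * m ^+ (e - i))).
  rewrite monicE lead_coefDl ?lead_coefXn // size_polyXn.
  exact: leq_ltn_trans (size_poly _ _) _.
set p := \poly_(i < _) _; pose M : F := m%:~R.
have px : (map_poly intr p).[M * x] = \sum_(i < e.+1) M ^+ e * ((q`_i)%:~R * x ^+ i).
  rewrite (@horner_coef_wide _ e.+1) ?(leq_trans (size_poly _ _)) ?size_poly //.
  apply: eq_bigr => i _; rewrite coef_map /= coef_poly ltn_ord intrM rmorphXn /= -/M.
  rewrite exprMn -[LHS]mulrA [X in _ * X]mulrA -exprD subnK -1?ltnS //.
  exact: mulrCA.
rewrite rmorphD /= map_polyXn rootE hornerD hornerXn px -mulr_sumr.
rewrite exprMn exprS (mulrC M) -!mulrA -mulrDr mulf_eq0; apply/orP; right.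
have mE : q`_e.+1 = m by rewrite /m lead_coefE szE.
move: qx; rewrite rootE (@horner_coef_wide _ e.+2); last first.
  by rewrite -szE; apply: size_poly.
rewrite big_ord_recr /= addrC coef_map /= mE -/M.
by congr (_ + _ == 0); apply: eq_bigr => i _; rewrite coef_map.
Qed.

(** Some integer multiple of the inverse of g is integral. *)
Lemma divides_int (g : R) : g != 0 -> exists2 m : int, m != 0 & divides g m%:~R.
Proof.
move=> g0; have [m m0 [h hE]] := clear_denominator (iota g)^-1.
exists m => //; exists h; apply: iota_inj; rewrite rmorph_int rmorphM hE mulfVK //.
by rewrite -(rmorph0 iota) (inj_eq iota_inj).
Qed.

Lemma frac_of_integers (x : F) : exists2 s : R, s != 0 & exists a, iota a = iota s * x.
Proof.
have [m m0 [a aE]] := clear_denominator x.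
exists m%:~R; last by exists a; rewrite rmorph_int.
by apply: contraNneq m0 => /(intr_ext_eq0 iota)->.
Qed.

Local Notation fdim := (\dim {:F}).

(** R/m has at most |m| ^ [F : Q] elements, without an integral basis of R: by
    the Smith normal form of the matrix of coordinates, the subgroup generated
    by finitely many r i has generators u j, themselves in R, of which at most
    [F : Q] are nonzero, and two r i whose coefficients on these agree modulo m
    are congruent modulo m. *)
Lemma incongruent_mod_int (m : int) N (r : 'I_N -> R) : m != 0 ->
    (forall i j, divides m%:~R (r i - r j) -> i = j) ->
  (N <= `|m| ^ fdim)%N.
Proof.
move=> m0 r_inj.
pose crd := coord (vbasis {:F}).
pose X (p : 'I_N * 'I_(fdim)) : rat := crd p.2 (iota (r p.1)).
have [D D0 DX] := common_denominator X.
have [A AE] := fin_all_exists DX.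
pose A' := \matrix_(i < N, j < fdim) A (i, j).
have [L Lu [R' _ [dd _ LE]]] := int_Smith_normal_form A'.
(* the generators u j, of which those with j >= [F : Q] vanish *)
pose u (j : 'I_N) : R := \sum_i (invmx L j i)%:~R * r i.
have sc (z : int) (x : F) : z%:~R * x = (z%:~R : rat) *: x.
  by rewrite mulrzl scaler_int.
have uE (j : 'I_N) k : D%:~R * crd k (iota (u j)) = ((invmx L *m A') j k)%:~R.
  rewrite /u /crd rmorph_sum linear_sum mulr_sumr mxE rmorph_sum.
  apply: eq_bigr => i _ /=.
  rewrite rmorphM rmorph_int sc linearZ /= !mxE intrM.
  by rewrite -(eqP (AE (i, k))) mulrCA.
have u0 (j : 'I_N) : (fdim <= j)%N -> u j = 0.
  move=> jd; apply: iota_inj; rewrite rmorph0.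
  rewrite (coord_vbasis (memvf (iota (u j)))) big1 // => k _.
  suff -> : coord (vbasis {:F}) k (iota (u j)) = 0 by rewrite scale0r.
  apply: (@mulfI _ (D%:~R : rat)); first by rewrite intr_eq0.
  rewrite uE mulr0 LE -!mulmxA mulKmx // mxE big1 // => l _; rewrite mxE.
  by rewrite gtn_eqF ?mulr0n ?mul0r // (leq_trans (ltn_ord l)).
have rE i : r i = \sum_j (L i j)%:~R * u j.
  rewrite /u; under eq_bigr do rewrite mulr_sumr.
  rewrite exchange_big /=; transitivity (\sum_k ((1%:M : 'M[int]_N) i k)%:~R * r k).
    rewrite (bigD1 i) //= big1 ?addr0 => [|k ki]; rewrite mxE ?eqxx ?mul1r //.
    by rewrite eq_sym (negPf ki) mul0r.
  apply: eq_bigr => k _; rewrite -(mulmxV Lu) mxE rmorph_sum mulr_suml.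
  by apply: eq_bigr => j _; rewrite /= intrM mulrA.
have mgt : (0 < `|m|)%N by rewrite absz_gt0.
pose c i (j : 'I_(fdim)) : 'I_(`|m|) :=
  let z := if insub (j : nat) is Some k then L i k else 0 in
  insubd (Ordinal mgt) `|(z %% m)%Z|%N.
have c_inj : injective (fun i => [ffun j => c i j]).
  move=> i i' /ffunP cE; apply: r_inj.
  have dvL (j : 'I_N) : exists z, (L i j - L i' j)%:~R * u j = z * m%:~R.
    have [/u0->|jd] := leqP (fdim) j; first by exists 0; rewrite mulr0 mul0r.
    have /(congr1 val) := cE (Ordinal jd); rewrite !ffunE /c /= valK.
    have modm z : (`|(z %% m)%Z| < `|m|)%N.
      by rewrite -ltz_nat gez0_abs ?modz_ge0 // ltz_mod.
    rewrite !val_insubd !modm => /(congr1 Posz).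
    rewrite !gez0_abs ?modz_ge0 // => /eqP; rewrite eqz_mod_dvd => /dvdzP[z ->].
    by exists (z%:~R * u j); rewrite intrM mulrAC.
  have [z zE] := fin_all_exists dvL.
  exists (\sum_j z j); rewrite !rE -sumrB mulr_suml; apply: eq_bigr => j _.
  by rewrite -zE intrB mulrBl.
have := leq_card _ c_inj; rewrite card_ord card_ffun !card_ord.
by [].
Qed.

(** A system of representatives of R/g. *)
Definition residues (g : R) (s : seq R) :=
  [/\ uniq s, forall a, exists2 b, b \in s & divides g (a - b)
    & forall a b, a \in s -> b \in s -> divides g (a - b) -> a = b].

Lemma finite_residues (g : R) : g != 0 -> exists s, residues g s.
Proof.
move=> /divides_int[m m0 [h mE]].
pose P k := `[< exists r : 'I_k -> R, forall i j, divides g (r i - r j) -> i = j >].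
have P0 : exists k, P k by exists 0%N; apply/asboolP; exists (fun=> 0); case.
have Pub k : P k -> (k <= `|m| ^ fdim)%N.
  move=> /asboolP[r rP]; apply: (incongruent_mod_int (r := r) m0) => i j [c cE].
  by apply: rP; exists (c * h); rewrite -mulrA -mE.
case: (ex_maxnP P0 Pub) => k /asboolP[r rP] kmax.
have r_inj : injective r.
  by move=> i j rij; apply: rP; exists 0; rewrite rij subrr mul0r.
exists (codom r); split=> [|a|_ _ /codomP[i ->] /codomP[j ->] /rP-> //].
  by rewrite codomE map_inj_uniq ?enum_uniq.
apply: contrapT => aN; have /kmax : P k.+1; last by rewrite ltnn.
have aN' i : ~ divides g (a - r i) by move=> ai; apply: aN; exists (r i); rewrite ?codom_f.
apply/asboolP; exists (fun i => if unlift ord0 i is Some j then r j else a) => i j.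
case: unliftP => [i' ->|->]; case: unliftP => [j' ->|->] //.
- by move=> /rP->.
- by move=> [c cE]; case: (aN' i'); exists (- c); rewrite mulNr -cE opprB.
- by move=> /aN'.
Qed.

End RingOfIntegers.

(** * Cardinalities of sets *)
Section CardIs.
Implicit Types (T U : eqType).

Definition card_is T (A : set T) (k : nat) :=
  exists s : seq T, [/\ uniq s, size s = k & forall x, x \in s <-> A x].

Lemma card_is_fset (T : choiceType) (A : set T) k :
  card_is A k -> #|` fset_set A|%fset = k.
Proof.
move=> [s [us <- sA]]; have finA : finite_set A.
  by apply/finite_seqP; exists s; apply/seteqP; split=> x /=; rewrite sA.
apply/perm_size/uniq_perm => // x; rewrite in_fset_set //.
by apply/idP/idP => [/set_mem/sA|/sA/mem_set].
Qed.

Lemma card_is_seq T (s : seq T) : uniq s -> card_is [set` s] (size s).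
Proof. by move=> us; exists s. Qed.

Lemma card_is_image T U (f : T -> U) (A : set T) (B : set U) k :
    card_is A k -> {in A &, injective f} ->
    (forall x, A x -> B (f x)) -> (forall y, B y -> exists2 x, A x & f x = y) ->
  card_is B k.
Proof.
move=> [s [us <- sA]] finj fAB fsurj; exists (map f s); split=> [|//|y].
- by rewrite map_inj_in_uniq // => x y /sA/mem_set xA /sA/mem_set; apply: finj.
- by rewrite size_map.
split=> [/mapP[x /sA xA ->]|/fsurj[x /sA xs <-]]; first exact: fAB.
exact: map_f.
Qed.

Lemma card_is_fibers T U (f : T -> U) (A : set T) (B : set U) k m :
    card_is B k -> (forall x, A x -> B (f x)) ->
    (forall y, B y -> card_is [set x | A x /\ f x = y] m) ->
  card_is A (k * m).
Proof.
move=> [s [us <- sB]] fAB fib.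
have /choice[t tP] y : exists r, y \in s ->
    [/\ uniq r, size r = m & forall x, x \in r <-> A x /\ f x = y].
  have [/sB/fib[r rP]|_] := boolP (y \in s); first by exists r.
  by exists [::].
exists (flatten (map t s)); split=> [||x].
- elim: s us {fAB fib sB} tP => //= y s IH /andP[ys us] tP.
  rewrite cat_uniq IH // ?andbT; last by move=> z zs; apply: tP; rewrite inE zs orbT.
  have [-> _ ty] := tP _ (mem_head _ _); rewrite /= -all_predC; apply/allP => x.
  move=> /flattenP[_ /mapP[z zs ->]] xz; apply/negP => /ty[_ fy].
  have [|_ _ tz] := tP z; first by rewrite inE zs orbT.
  by move: xz => /tz[_ fz]; rewrite -fy fz zs in ys.
- rewrite size_flatten /shape -map_comp.
  elim: s us {fAB fib sB} tP => //= y s IH /andP[ys us] tP.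
  rewrite mulSn IH // => [|z zs]; last by apply: tP; rewrite inE zs orbT.
  by have [_ -> _] := tP _ (mem_head _ _).
- split=> [/flattenP[_ /mapP[y /tP[_ _ ty] ->]] /ty[]//|xA].
  apply/flattenP; exists (t (f x)); first by apply/map_f/sB/fAB.
  by have /tP[_ _ ->] : f x \in s by apply/sB/fAB.
Qed.

Lemma card_is_leq T (A B : set T) k m :
  card_is A k -> card_is B m -> A `<=` B -> (k <= m)%N.
Proof.
move=> [s [us <- sA]] [t [_ <- tB]] AB; apply: uniq_leq_size => // x.
by move=> /sA/AB/tB.
Qed.

Lemma card_is_eq T (A B : set T) k m :
  card_is A k -> card_is B m -> A `<=` B -> (m <= k)%N -> A = B.
Proof.
move=> [s [us <- sA]] [t [ut <- tB]] AB ts; apply/seteqP; split=> // x /tB xt.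
apply/sA; have st : {subset s <= t} by move=> y /sA/AB/tB.
by have [_ ->] := uniq_min_size us st ts.
Qed.

Lemma card_is_inj T (A : set T) k m : card_is A k -> card_is A m -> k = m.
Proof.
by move=> Ak Am; apply/eqP; rewrite eqn_leq !(card_is_leq (A := A) (B := A)).
Qed.

End CardIs.

(** * Extensions of homomorphisms to Q(R)/R *)
Section Extensions.
Variables (R : idomainType) (T D : lmodType R).
Hypothesis Rpid : is_PID R.
Hypothesis Ddiv : forall (g : R) (d : D), g != 0 -> exists d', g *: d' = d.
Hypothesis Dtor : forall (g : R) (s : seq R), g != 0 -> residues g s ->
  card_is [set d : D | g *: d = 0] (size s).
Hypothesis Rres : forall g : R, g != 0 -> exists s, residues g s.
Hypothesis Ttor : forall x : T, exists2 a : R, a != 0 & a *: x = 0.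

Definition submodule (S : set T) := S 0 /\ forall a x y, S x -> S y -> S (a *: x + y).

Definition linear_on (S : set T) (phi : T -> D) :=
  forall a x y, S x -> S y -> phi (a *: x + y) = a *: phi x + phi y.

Definition extensions (S : set T) (phi : T -> D) : set (T -> D) :=
  [set f | linear_on setT f /\ forall x, S x -> f x = phi x].

Lemma submodule_sub S x y : submodule S -> S x -> S y -> S (x - y).
Proof. by move=> [_ SP] Sx Sy; rewrite addrC -scaleN1r; apply: SP. Qed.

Lemma submodule_scale S a x : submodule S -> S x -> S (a *: x).
Proof. by move=> [S0 SP] Sx; rewrite -[_ *: _]addr0; apply: SP. Qed.

Lemma submodule_add S x y : submodule S -> S x -> S y -> S (x + y).
Proof. by move=> [_ SP] Sx Sy; rewrite -[x]scale1r; apply: SP. Qed.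

Definition adjoin (S : set T) (x : T) : set T := [set y | exists a, S (y - a *: x)].

Lemma adjoin_submodule S x : submodule S -> submodule (adjoin S x).
Proof.
move=> SS; split=> [|a y z [b yb] [c zc]].
  by exists 0; rewrite scale0r subrr; case: SS.
exists (a * b + c); rewrite scalerDl opprD addrACA -scalerA -scalerBr.
by case: SS => _; apply.
Qed.

Lemma submodule_coef S x y a b : submodule S ->
  S (y - a *: x) -> S (y - b *: x) -> S ((a - b) *: x).
Proof.
move=> SS Sa Sb; have -> : (a - b) *: x = (y - b *: x) - (y - a *: x).
  by rewrite scalerBl opprB [RHS]addrC addrA subrK.
exact: submodule_sub.
Qed.

(** The a with a x in S form an ideal, nonzero because x is torsion. *)
Lemma adjoin_generator S x : submodule S -> exists2 g, g != 0 &
  forall a, S (a *: x) <-> divides g a.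
Proof.
move=> SS; have [] := @Rpid [set a | S (a *: x)].
- by rewrite /= scale0r; case: SS.
- by move=> a b c /= Sb Sc; rewrite scalerDl -scalerA; case: SS => _; apply.
move=> g gE; exists g; last first.
  move=> a; rewrite -[S _]/([set a | S (a *: x)] a) gE; split=> [[b _ <-]|[b ->]].
    by exists b.
  by exists b.
have [a a0 ax] := Ttor x; apply: contraNneq a0 => g0.
have : [set a | S (a *: x)] a by rewrite /= ax; case: SS.
by rewrite gE => -[b _ <-]; rewrite g0 mulr0.
Qed.

(** An element of the sum of S and R x has a unique expression u + r x with u in
    S and r among the representatives. *)
Lemma adjoin_card S x p (g : R) (s : seq R) : submodule S -> card_is S p ->
    (forall a, S (a *: x) <-> divides g a) -> residues g s ->
  card_is (adjoin S x) (size s * p).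
Proof.
move=> SS Sp gP [us sall sinj].
pose f y := xget 0 [set r | r \in s /\ S (y - r *: x)].
have fP y r : r \in s -> S (y - r *: x) -> f y = r.
  move=> rs Sr; rewrite /f; case: xgetP => [b _ [bs Sb]|/(_ r)[]] //.
  by apply: sinj => //; apply/gP/(submodule_coef SS Sb).
apply: (card_is_fibers (f := f) (card_is_seq us)) => [y [a Sa]|r rs].
  have [b bs [c cE]] := sall a.
  rewrite (fP y b) //; have -> : y - b *: x = (y - a *: x) + (a - b) *: x.
    by rewrite scalerBl addrA subrK.
  by apply: submodule_add => //; apply/gP; exists c.
apply: (card_is_image (f := fun y => y + r *: x) Sp) => [y z _ _ /addIr //|y Sy|y [[a Sa] fy]].
  by split; [exists r|apply: fP]; rewrite ?addrK.
exists (y - r *: x); rewrite ?subrK //.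
have [b bs [c cE]] := sall a.
have Sb : S (y - b *: x).
  have -> : y - b *: x = (y - a *: x) + (a - b) *: x by rewrite scalerBl addrA subrK.
  by apply: submodule_add => //; apply/gP; exists c.
by rewrite -fy (fP y b).
Qed.

(** A translate of the g-torsion, nonempty by divisibility. *)
Lemma solutions_card (g : R) (s : seq R) (d0 : D) : g != 0 -> residues g s ->
  card_is [set d | g *: d = d0] (size s).
Proof.
move=> g0 gs; have [d1 d1E] := Ddiv d0 g0.
apply: (card_is_image (f := fun d => d + d1) (Dtor g0 gs)) => [d e _ _ /addIr //|d /= gd|d /= gd].
  by rewrite scalerDr gd add0r.
by exists (d - d1); rewrite ?subrK //= scalerBr gd d1E subrr.
Qed.

Lemma linear_on0 S phi : submodule S -> linear_on S phi -> phi 0 = 0.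
Proof.
move=> [S0 _] /(_ 1 0 0 S0 S0); rewrite scaler0 addr0 scale1r => /eqP.
by rewrite addrC -subr_eq subrr => /eqP.
Qed.

(** Induction on the index of S in T.  An extension of phi to S + R x is the same
    as a solution d of g d = phi (g x), and by induction each of these has the
    same number of extensions to T. *)
Lemma card_extensions (S : set T) (phi : T -> D) (p q : nat) :
    submodule S -> linear_on S phi -> card_is S p -> card_is [set: T] q ->
  exists2 k, card_is (extensions S phi) k & (k * p)%N = q.
Proof.
move: {2}(q - p)%N (leqnn (q - p)) => m; elim: m S phi p => [|m IH] S phi p qp SS phiS Sp Tq.
  have ST := card_is_eq Sp Tq (@subsetT _ S) _.
  have {}ST : S = setT by apply: ST; rewrite -subn_eq0 -leqn0.
  exists 1%N; last by rewrite mul1n; apply: card_is_inj Sp _; rewrite ST.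
  exists [:: phi]; split=> // f; rewrite inE; split=> [/eqP->|[_ fphi]].
    by split=> //; rewrite -ST.
  by apply/eqP/funext => x; apply: fphi; rewrite ST.
have [ST|/existsNP[x Sx]] := pselect (forall x, S x).
  have {}ST : S = setT by apply/seteqP; split.
  apply: IH => //; rewrite (card_is_inj (A := S) Sp (m := q)) ?subnn // ST //.
have [g g0 gP] := adjoin_generator x SS; have [s gs] := Rres g0.
have S1p := adjoin_card SS Sp gP gs.
have SS1 : S `<=` adjoin S x by move=> y Sy; exists 0; rewrite scale0r subr0.
have S1x : adjoin S x x by exists 1; rewrite scale1r subrr; case: SS.
have lt_p : (p < size s * p)%N.
  by rewrite ltnNge; apply/negP => /(card_is_eq Sp S1p SS1) E; apply: Sx; rewrite E.
have ext d : g *: d = phi (g *: x) -> exists psi, [/\ linear_on (adjoin S x) psi,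
    forall y, S y -> psi y = phi y & psi x = d].
  (* s + a x is sent to phi s + a d; this does not depend on the choice of a *)
  move=> gd; pose c y := xget 0 [set a | S (y - a *: x)].
  pose psi y := phi (y - c y *: x) + c y *: d.
  have psiE y a : S (y - a *: x) -> psi y = phi (y - a *: x) + a *: d.
    move=> Sa; have Sc : S (y - c y *: x).
      by rewrite /c; case: xgetP => [b _ //|/(_ a)].
    have /gP[b bE] := submodule_coef SS Sa Sc.
    rewrite /psi (_ : c y = a - b * g); last by rewrite -bE subKr.
    have -> : y - (a - b * g) *: x = b *: (g *: x) + (y - a *: x).
      by rewrite scalerBl opprB addrCA scalerA.
    rewrite phiS //; last by apply/gP; exists 1; rewrite mul1r.
    by rewrite -gd scalerA scalerBl addrC addrA subrK addrC.
  exists psi; split=> [a y z [b yb] [e ze]|y Sy|].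
  - rewrite (psiE y b) // (psiE z e) // (psiE _ (a * b + e)).
      rewrite scalerDl opprD addrACA -scalerA -scalerBr phiS //.
      by rewrite scalerDr scalerDl scalerA addrACA.
    rewrite scalerDl opprD addrACA -scalerA -scalerBr.
    by case: SS => _; apply.
  - by rewrite (psiE y 0) scale0r subr0 ?scale0r ?addr0.
  - by rewrite (psiE x 1) scale1r subrr ?scale1r ?(linear_on0 SS phiS) ?add0r //; case: SS.
have fib d : g *: d = phi (g *: x) -> exists2 k,
    card_is [set f | extensions S phi f /\ f x = d] k & (k * (size s * p))%N = q.
  move=> /ext[psi [psiS1 psiS psix]].
  have [|k kext <-] := IH _ psi _ _ (adjoin_submodule x SS) psiS1 S1p Tq.
    by rewrite leq_subLR (leq_trans _ (leq_add lt_p (leqnn m))) // addSnnS -leq_subLR.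
  exists k => //; rewrite (_ : mkset _ = extensions (adjoin S x) psi) //.
  apply/seteqP; split=> f /= [].
    move=> [flin fS] fx; split=> // y [a Sa].
    rewrite -[y](subrK (a *: x)) addrC flin // fx (fS _ Sa) psiS1 //; last exact: SS1.
    by rewrite psix (psiS _ Sa).
  move=> flin fS1; split; last by rewrite fS1.
  by split=> // y Sy; rewrite fS1 ?psiS //; apply: SS1.
have [d0 d0E] := Ddiv (phi (g *: x)) g0.
have [k kfib kq] := fib d0 d0E.
exists (size s * k)%N; last by rewrite -kq mulnAC mulnC.
apply: (card_is_fibers (f := fun f : T -> D => f x) (solutions_card (phi (g *: x)) g0 gs)).
  move=> f [flin fS]; rewrite /= -fS; last by apply/gP; exists 1; rewrite mul1r.
  by have := flin g x 0 I I; rewrite !addr0 (linear_on0 _ flin) ?addr0.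
move=> d gd; have [k' k'fib k'q] := fib d gd.
suff -> : k = k' by [].
by apply/eqP; rewrite -(eqn_pmul2r (leq_trans (ltn0Sn p) lt_p)) kq k'q.
Qed.

End Extensions.

Section FracMod.
Variables (F : fieldType) (R : idomainType) (iota : {rmorphism R -> F}).
Hypothesis iota_inj : injective iota.
Local Notation FR := (restriction iota F^o).
Local Notation D := (frac_mod iota).
Local Notation cls := (@qproj R FR (range iota)).

Lemma span_range_iota (y : F) : Defs.span (range iota : set FR) y <-> exists a, y = iota a.
Proof.
split=> [[s [sG ->]]|[a ->]]; last first.
  exists [:: (1, iota a : FR)]; split; last by rewrite big_seq1 scale1r.
  by move=> p; rewrite inE => /eqP->; exists a.
elim: s sG => [|p s IH] sG; first by exists 0; rewrite big_nil rmorph0.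
have [|a aE] := IH; first by move=> q qs; apply: sG; rewrite inE qs orbT.
have [b _ bE] := sG p (mem_head _ _).
by exists (p.1 * b + a); rewrite big_cons aE -bE rmorphD rmorphM.
Qed.

Lemma cls_scale g (y : F) : g *: cls y = cls (iota g * y).
Proof. by rewrite -linearZ. Qed.

Lemma cls_eq (y z : F) : cls y = cls z <-> exists a, y - z = iota a.
Proof.
rewrite -span_range_iota; split=> [/eqP|yz].
  by rewrite qproj_eq => /asboolP.
by apply/eqP; rewrite qproj_eq; apply/asboolP.
Qed.

Lemma frac_mod_divisible (g : R) (d : D) : g != 0 -> exists d', g *: d' = d.
Proof.
move=> g0; have [y ->] := qprojP d; exists (cls (y / iota g)).
by rewrite cls_scale mulrC divfK ?(raddf_eq0 _ iota_inj).
Qed.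

(** The g-torsion of Q(R)/R consists of the classes of r / g. *)
Lemma frac_mod_torsion (g : R) (s : seq R) : g != 0 -> residues g s ->
  card_is [set d : D | g *: d = 0] (size s).
Proof.
move=> g0 [us sall sinj]; have ig0 : iota g != 0 by rewrite (raddf_eq0 _ iota_inj).
have cls0 : cls 0 = 0 by exact: linear0.
apply: (card_is_image (f := fun r => cls (iota r / iota g)) (card_is_seq us)).
- move=> a b /set_mem /= sa /set_mem /= sb /cls_eq[c].
  rewrite -mulrBl -rmorphB => cE; apply: sinj => //; exists c.
  by apply: iota_inj; rewrite rmorphM -cE divfK.
- move=> a _ /=; rewrite cls_scale mulrC divfK // -cls0; apply/cls_eq.
  by exists a; rewrite subr0.
- move=> d /=; have [y ->] := qprojP d; rewrite cls_scale -cls0 => /cls_eq[a].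
  rewrite subr0 => aE; have [b bs [c cE]] := sall a.
  exists b => //; apply/cls_eq; exists (- c); apply: (mulIf ig0).
  by rewrite mulrBl divfK // [y * _]mulrC aE -rmorphB -opprB cE -rmorphM mulNr.
Qed.

End FracMod.

(** * Finiteness of the torsion *)
Section FiniteTorsion.
Variables (R : idomainType) (N : lmodType R).
Hypothesis Rres : forall g : R, g != 0 -> exists s, residues g s.
Local Notation tors := (@torsion_pred R N).

Definition covered (A : set N) := exists s : seq N, forall x, A x -> x \in s.

(** If g x is in S for some g <> 0, then the torsion elements of S + R x fall into
    finitely many classes, according to the coefficient of x modulo g, and each
    class is a translate of the torsion of S.  If not, a torsion element has no
    component along x. *)
Lemma adjoin_torsion_covered (S : set N) x : submodule S ->
    covered [set y | S y /\ y \in tors] ->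
  covered [set y | adjoin S x y /\ y \in tors].
Proof.
move=> SS [s sP]; have [[g [g0 gx]]|gN] := pselect (exists g, g != 0 /\ S (g *: x)).
  have [rs [_ rall _]] := Rres g0.
  pose t r := xget 0 [set y | y \in tors /\ S (y - r *: x)].
  exists [seq t r + u | r <- rs, u <- s] => y [[a Sa] yt].
  have [r rrs [c cE]] := rall a.
  have Sr : S (y - r *: x).
    have -> : y - r *: x = (y - a *: x) + (a - r) *: x.
      by rewrite scalerBl addrA subrK.
    by apply: submodule_add => //; rewrite cE -scalerA; apply: submodule_scale.
  have [tt St] : t r \in tors /\ S (t r - r *: x).
    by rewrite /t; case: xgetP => [z _ //|/(_ y)[]].
  apply/allpairsP; exists (r, y - t r); split=> //=; last by rewrite addrC subrK.
  apply: sP; split; last exact: rpredB.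
  have -> : y - t r = (y - r *: x) - (t r - r *: x) by rewrite opprB addrA subrK.
  exact: submodule_sub.
exists s => y [[a Sa] yt]; apply: sP; split=> //.
have /asboolP[c c0 cy] := yt.
suff a0 : a = 0 by move: Sa; rewrite a0 scale0r subr0.
apply/eqP; apply: contraPT gN => a0; apply; exists (- (c * a)); split.
  by rewrite oppr_eq0 mulf_neq0.
by rewrite -[X in S X]add0r -cy scaleNr -scalerA -scalerBr; apply: submodule_scale.
Qed.

Fixpoint span_seq (xs : seq N) : set N :=
  if xs is x :: xs' then adjoin (span_seq xs') x else [set 0].

Lemma span_seq_submodule xs : submodule (span_seq xs).
Proof.
elim: xs => [|x xs IH] /=; last exact: adjoin_submodule.
by split=> // a y z /= -> ->; rewrite scaler0 addr0.
Qed.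

Lemma mem_span_seq xs x : x \in xs -> span_seq xs x.
Proof.
elim: xs => //= y xs IH; rewrite inE => /orP[/eqP->|/IH xxs].
  by exists 1; rewrite scale1r subrr; case: (span_seq_submodule xs).
by exists 0; rewrite scale0r subr0.
Qed.

Lemma span_seqP xs x : Defs.span [set` xs] x -> span_seq xs x.
Proof.
move=> [s [sG ->]]; have SS := span_seq_submodule xs.
elim: s sG => [|p s IH] sG; first by rewrite big_nil; case: SS.
rewrite big_cons; case: (SS) => _; apply; first exact/mem_span_seq/sG/mem_head.
by apply: IH => q qs; apply: sG; rewrite inE qs orbT.
Qed.

Lemma finite_torsion : finitely_generated N -> exists k, card_is [set: torsion N] k.
Proof.
move=> [xs xsP].
have [s sP] : covered [set y | span_seq xs y /\ y \in tors].
  elim: xs {xsP} => [|x xs IH] /=; first by exists [:: 0] => y [-> _]; rewrite inE.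
  exact: adjoin_torsion_covered (span_seq_submodule xs) IH.
pose t := undup (pmap (insub : N -> option (torsion N)) s).
exists (size t), t; split=> [||x]; rewrite ?undup_uniq //; split=> // _.
rewrite mem_undup mem_pmap; apply/mapP; exists (val x); last by rewrite valK.
by apply: sP; split; [apply/span_seqP/xsP|apply: valP].
Qed.

End FiniteTorsion.

(** * Ranks *)
Section FreeFamilies.
Variables (F : fieldType) (W : vectType F) (I : eqType) (f : I -> W).

Lemma free_map_eq0 (s : seq I) (c : I -> F) : free (map f s) ->
  \sum_(i <- s) c i *: f i = 0 -> forall i, i \in s -> c i = 0.
Proof.
elim: s => //= j s IH; rewrite free_cons big_cons => /andP[js fs] s0 i.
have span_s : \sum_(i <- s) c i *: f i \in <<map f s>>%VS.
  by rewrite big_seq memv_suml // => k ks; rewrite memvZ ?memv_span ?map_f.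
have cj : c j = 0.
  apply: contraNeq js => cj; rewrite -[f j](scalerK cj) memvZ //.
  by move: s0 => /(canRL (addrK _)); rewrite add0r => ->; rewrite memvN.
move: s0; rewrite cj scale0r add0r => s0.
by rewrite inE => /orP[/eqP->//|]; apply: IH.
Qed.

Lemma mem_span_map (s : seq I) v : uniq s -> v \in <<map f s>>%VS ->
  exists c : I -> F, v = \sum_(i <- s) c i *: f i.
Proof.
elim: s v => [|j s IH] v /=.
  by rewrite span_nil memv0 => _ /eqP->; exists (fun=> 0); rewrite big_nil.
rewrite span_cons => /andP[js us] /memv_addP[x /vlineP[k ->] [y ys ->]].
have [c ->] := IH y us ys.
exists (fun i => if i == j then k else c i); rewrite big_cons eqxx; congr (_ + _).
by apply: eq_big_seq => i iis; case: eqP => // ij; rewrite -ij iis in js.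
Qed.

Lemma free_subseq_span (s : seq I) : exists t : seq I,
  free (map f t) /\ <<map f t>>%VS = <<map f s>>%VS.
Proof.
elim: s => [|i s [t [tf ts]]] /=; first by exists [::]; rewrite nil_free.
have [it|it] := boolP (f i \in <<map f t>>%VS); last first.
  by exists (i :: t); rewrite /= free_cons it tf !span_cons ts.
exists t; split=> //; rewrite span_cons -ts.
by apply/esym/addv_idPr; rewrite -memvE.
Qed.

End FreeFamilies.

Lemma span_of_set (F : fieldType) (W : vectType F) (P : set W) : exists s : seq W,
  (forall v, v \in s -> P v) /\ (forall v, P v -> v \in <<s>>%VS).
Proof.
suff gen k (s : seq W) : (forall v, v \in s -> P v) -> (\dim {:W} - \dim <<s>> <= k)%N ->
    exists s : seq W, (forall v, v \in s -> P v) /\ (forall v, P v -> v \in <<s>>%VS).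
  by apply: (gen _ [::]) (leqnn _).
elim: k s => [|k IH] s sP sk.
  exists s; split=> // v _; suff -> : <<s>>%VS = {:W}%VS by rewrite memvf.
  by apply/eqP; rewrite eqEdim subvf -subn_eq0 -leqn0.
have [sall|/existsNP[v /not_implyP[Pv vs]]] := pselect (forall v, P v -> v \in <<s>>%VS).
  by exists s.
apply: (IH (v :: s)) => [w|]; first by rewrite inE => /orP[/eqP->|/sP].
have sv : (<<s>> <= <<v :: s>>)%VS by rewrite span_cons addvSr.
have lt_s : (\dim <<s>> < \dim <<v :: s>>)%N.
  rewrite ltnNge; apply/negP => vle; apply: vs.
  have /eqP -> : <<s>>%VS == <<v :: s>>%VS by rewrite eqEdim sv.
  by rewrite memv_span ?mem_head.
by rewrite leq_subLR (leq_trans _ (leq_add lt_s (leqnn k))) // addSnnS -leq_subLR.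
Qed.

Section Fractions.
Variables (F : fieldType) (R : idomainType) (iota : {rmorphism R -> F}).
Hypothesis iota_inj : injective iota.
Hypothesis fracs : forall c : F, exists2 s : R, s != 0 & exists a, iota a = iota s * c.

Lemma common_denominator_frac (I : eqType) (s : seq I) (c : I -> F) :
  exists2 d : R, d != 0 & exists a : I -> R, forall i, i \in s -> iota (a i) = iota d * c i.
Proof.
elim: s => [|j s [d d0 [a aE]]]; first by exists 1; rewrite ?oner_neq0 //; exists (fun=> 0).
have [e e0 [b bE]] := fracs (c j).
exists (d * e); first by rewrite mulf_neq0.
exists (fun i => if i == j then d * b else e * a i) => i.
rewrite inE; case: (eqVneq i j) => [-> _|_ /= /aE]; rewrite !rmorphM.
  by rewrite bE mulrA.
by move->; rewrite mulrA (mulrC (iota e)).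
Qed.

Section Localization.
Variables (N : lmodType R) (W : vectType F) (phi : N -> W).

(** A model of the base change of N to F inside W: by loc_ker the F-span of the
    image of phi is the localization of N, whatever W is. *)
Record localization : Prop := Localization {
  loc_linear : forall a x y, phi (a *: x + y) = iota a *: phi x + phi y;
  loc_ker : forall x, phi x = 0 <-> x \in @torsion_pred R N
}.

Hypothesis loc : localization.

Lemma loc0 : phi 0 = 0.
Proof. by apply/(loc_ker loc); apply: rpred0. Qed.

Lemma locZ a x : phi (a *: x) = iota a *: phi x.
Proof. by rewrite -[a *: x]addr0 (loc_linear loc) loc0 addr0. Qed.

Lemma locD x y : phi (x + y) = phi x + phi y.
Proof. by have := loc_linear loc 1 x y; rewrite rmorph1 !scale1r. Qed.

Lemma locB x y : phi (x - y) = phi x - phi y.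
Proof. by rewrite locD -[- y]scaleN1r locZ rmorphN1 scaleN1r. Qed.

Lemma loc_sum (I : eqType) (s : seq I) (g : I -> N) :
  phi (\sum_(i <- s) g i) = \sum_(i <- s) phi (g i).
Proof. exact: (big_morph phi locD loc0). Qed.

(** Dependence over F of images is dependence over R, up to torsion: clear the
    denominators. *)
Lemma loc_span (I : eqType) (s : seq I) (g : I -> N) x : uniq s ->
    phi x \in <<[seq phi (g i) | i <- s]>>%VS <->
  exists2 d, d != 0 & exists a : I -> R, d *: x = \sum_(i <- s) a i *: g i.
Proof.
move=> us; split=> [/(mem_span_map us)[c xE]|[d d0 [a dx]]].
  have [d d0 [a aE]] := common_denominator_frac s c.
  have /(loc_ker loc)/asboolP[e e0 eE] : phi (d *: x - \sum_(i <- s) a i *: g i) = 0.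
    rewrite locB locZ loc_sum xE scaler_sumr; apply/eqP; rewrite subr_eq0; apply/eqP.
    by apply: eq_big_seq => i iis; rewrite locZ aE // scalerA.
  exists (e * d); first by rewrite mulf_neq0.
  exists (fun i => e * a i); apply/eqP; rewrite -subr_eq0 -[X in _ == X]eE.
  rewrite scalerBr scaler_sumr scalerA; apply/eqP; congr (_ - _).
  by apply: eq_bigr => i _; rewrite scalerA.
have : iota d *: phi x \in <<[seq phi (g i) | i <- s]>>%VS.
  rewrite -locZ dx loc_sum big_seq memv_suml // => i iis.
  by rewrite locZ memvZ ?memv_span ?(map_f (fun i => phi (g i))).
by rewrite rpredZeq (raddf_eq0 _ iota_inj) (negPf d0).
Qed.

Local Notation BC := (base_change iota N).
Local Notation rel := (@base_change_rel R F iota N).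
Local Notation V := {malg F[N]}.

Definition bc (x : N) : BC := @qproj F V rel << x >>.

Lemma bcD x y : bc (x + y) = bc x + bc y.
Proof.
apply/eqP; rewrite -subr_eq0 -[X in _ - X]linearD -linearB; apply/eqP/qproj0P.
exists [:: (1, << x + y >> - << x >> - << y >>)]; split.
  by move=> p; rewrite inE => /eqP->; left; exists x, y.
by rewrite big_seq1 scale1r /= opprD addrA.
Qed.

Lemma bcZ a x : bc (a *: x) = iota a *: bc x.
Proof.
apply/eqP; rewrite -subr_eq0 -[X in _ - X]linearZ -linearB; apply/eqP/qproj0P.
exists [:: (1, << a *: x >> - iota a *: << x >>)]; split.
  by move=> p; rewrite inE => /eqP->; right; exists a, x.
by rewrite big_seq1 scale1r.
Qed.

Lemma bc0 : bc 0 = 0.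
Proof. by rewrite -(scale0r (0 : N)) bcZ rmorph0 scale0r. Qed.

Lemma bc_sum (I : eqType) (s : seq I) (g : I -> N) :
  bc (\sum_(i <- s) g i) = \sum_(i <- s) bc (g i).
Proof. exact: (big_morph bc bcD bc0). Qed.

Lemma bc_gen (u : BC) : exists p : V, u = \sum_(x <- msupp p) p@_x *: bc x.
Proof.
have [p ->] := qprojP u; exists p; rewrite {1}[p]monalgE linear_sum /=.
apply: eq_bigr => x _; rewrite -linearZ; congr qproj.
by apply/malgP => y; rewrite mcoeffZ !mcoeffU mulr_natr.
Qed.

(** A linear form on W composed with phi extends to the base change, which is
    given by generators and relations; this separates its elements. *)
Definition bc_form (l : {linear W -> F^o}) : V -> F := mmap idfun (fun x => l (phi x)).

Lemma bc_formB l : {morph bc_form l : p q / p - q}.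
Proof. exact: mmap_is_additive. Qed.

Lemma bc_formU l k x : bc_form l << k *g x >> = k * l (phi x).
Proof. exact: mmapU. Qed.

Lemma bc_formZ l k p : bc_form l (k *: p) = k * bc_form l p.
Proof.
rewrite /bc_form (mmapEw (msuppZ_le k p)) mmapE mulr_sumr.
by apply: eq_bigr => x _; rewrite mcoeffZ mulrA.
Qed.

Lemma bc_form0 l : bc_form l 0 = 0.
Proof. by rewrite -(subrr (0 : V)) bc_formB subrr. Qed.

Lemma bc_formD l : {morph bc_form l : p q / p + q}.
Proof.
by move=> p q; rewrite -{1}[q]opprK -[- q]add0r !bc_formB bc_form0 sub0r opprK.
Qed.

Lemma bc_form_rel l p : Defs.span rel p -> bc_form l p = 0.
Proof.
move=> [s [sG ->]]; rewrite (big_morph (bc_form l) (@bc_formD l) (bc_form0 l)).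
rewrite big1_seq // => q /andP[_ /sG qG]; rewrite bc_formZ.
case: qG => [[x [y ->]]|[a [x ->]]]; rewrite ?bc_formB ?bc_formZ !bc_formU !mul1r.
  by rewrite locD linearD /= addrAC addrK subrr mulr0.
by rewrite locZ linearZ subrr mulr0.
Qed.

(** A free subfamily of the images phi x gives a basis of the base change:
    independent by the coordinate forms, generating by clearing denominators. *)
Lemma generic_rank_loc (xs : seq N) : (forall x, phi x \in <<map phi xs>>%VS) ->
  generic_rank iota N = \dim <<map phi xs>>%VS.
Proof.
move=> phi_xs; have [ys [ysf ysE]] := free_subseq_span phi xs.
rewrite -ysE (eqnP ysf) size_map; apply: has_dim_vdim.
have us : uniq ys by have /free_uniq/map_uniq := ysf.
exists (fun i : 'I_(size ys) => bc (tnth (in_tuple ys) i)); split=> [//|u _|c c0 i].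
  apply/span_rangeP; have [p ->] := bc_gen u.
  have spanned x : exists d : 'I_(size ys) -> F, bc x = \sum_i d i *: bc (tnth (in_tuple ys) i).
    have xys : phi x \in <<map phi ys>>%VS by rewrite ysE.
    have [d d0 [a dx]] := (loc_span id x us).1 xys.
    exists (fun i => iota (a (tnth (in_tuple ys) i)) / iota d).
    have id0 : iota d != 0 by rewrite (raddf_eq0 _ iota_inj).
    apply: (scalerI id0); rewrite -bcZ dx bc_sum scaler_sumr big_tnth.
    by apply: eq_bigr => i _; rewrite bcZ scalerA mulrC divfK.
  elim/big_rec: _ => [|x y _ [d ->]].
    by exists (fun=> 0); rewrite big1 // => i _; rewrite scale0r.
  have [e ->] := spanned x; exists (fun i => p@_x * e i + d i).
  rewrite scaler_sumr -big_split /=; apply: eq_bigr => i _.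
  by rewrite scalerDl scalerA.
pose X := map_tuple phi (in_tuple ys).
have coordX j : coord X i (phi (tnth (in_tuple ys) j)) = (j == i)%:R.
  rewrite -(coord_free (X := X) j i ysf) (tnth_nth 0) -(nth_map 0 0) //.
have formX j : bc_form (coord X i) << tnth (in_tuple ys) j >> = (j == i)%:R.
  by rewrite bc_formU mul1r -coordX.
have /bc_form_rel : Defs.span rel (\sum_j c j *: << tnth (in_tuple ys) j >>).
  apply/qproj0P; rewrite -[RHS]c0 linear_sum.
  by apply: eq_bigr => j _; rewrite -linearZ.
move=> /(_ (coord X i)); rewrite (big_morph _ (@bc_formD _) (bc_form0 _)).
rewrite (bigD1 i) //= big1 => [|j ji].
  by rewrite bc_formZ formX addr0 eqxx mulr1.
by rewrite bc_formZ formX (negPf ji) mulr0.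
Qed.

End Localization.
End Fractions.

Section Coprojection.
Variables (F : fieldType) (W : vectType F) (U : {vspace W}).

(** The quotient by U, realized on a complement of U so that it stays inside W. *)
Definition coproj : 'End(W) := (\1 - projv U)%VF.

Lemma coproj_eq0 v : (coproj v == 0) = (v \in U).
Proof.
rewrite /coproj add_lfunE opp_lfunE id_lfunE subr_eq0.
by apply/eqP/idP => [->|/projv_id->//]; apply: memv_proj.
Qed.

Lemma dim_coproj (W0 : {vspace W}) : (U <= W0)%VS ->
  \dim (coproj @: W0) = (\dim W0 - \dim U)%N.
Proof.
move=> UW; rewrite -(limg_ker_dim coproj W0).
suff -> : (W0 :&: lker coproj)%VS = U by rewrite addKn.
by apply/vspaceP => v; rewrite memv_cap memv_ker coproj_eq0 andbC; case: (boolP (v \in U)) => //= /(subvP UW).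
Qed.

End Coprojection.

Section Ranks.
Variables (F : fieldType) (R : idomainType) (iota : {rmorphism R -> F}).
Hypothesis iota_inj : injective iota.
Hypothesis fracs : forall c : F, exists2 s : R, s != 0 & exists a, iota a = iota s * c.

(** Present N as R^m / K and divide F^m by the span of K; a relation that holds in
    that quotient holds in N up to a nonzero scalar. *)
Lemma localization_exists (N : lmodType R) : finitely_generated N ->
  exists (W : vectType F) (phi : N -> W) (xs : seq N),
    localization iota phi /\ forall x, phi x \in <<map phi xs>>%VS.
Proof.
move=> [xs xsP]; pose m := size xs.
pose lin (c : 'rV[R]_m) : N := \sum_i c 0 i *: tnth (in_tuple xs) i.
have linP x : exists c, x = lin c.
  have /span_imageP[c cE] : Defs.span (tnth (in_tuple xs) @` [set` [set: 'I_m]%SET]) x.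
    apply: span_subset (xsP x) => y /= /(@tnthP _ _ (in_tuple xs) y)[i ->]; exists i => //=.
    by rewrite finset.in_setT.
  exists (\row_i c i); rewrite cE /lin; apply: eq_big => i; rewrite ?finset.in_setT //.
  by rewrite mxE.
have lin_lin a c d : lin (a *: c + d) = a *: lin c + lin d.
  rewrite /lin scaler_sumr -big_split /=; apply: eq_bigr => i _.
  by rewrite !mxE scalerDl scalerA.
have lin0 : lin 0 = 0 by rewrite /lin big1 // => i _; rewrite mxE scale0r.
have linZ a c : lin (a *: c) = a *: lin c by rewrite -[a *: c]addr0 lin_lin lin0 addr0.
have linB c d : lin (c - d) = lin c - lin d.
  have -> : c - d = -1 *: d + c by rewrite scaleN1r addrC.
  by rewrite lin_lin scaleN1r addrC.
pose W : vectType F := 'rV[F]_m.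
pose ic (c : 'rV[R]_m) : W := map_mx iota c.
have ic_lin a c d : ic (a *: c + d) = iota a *: ic c + ic d.
  by rewrite /ic map_mxD map_mxZ.
have ic_inj : injective ic.
  by move=> c d /rowP cd; apply/rowP => i; have := cd i; rewrite !mxE => /iota_inj.
have icZ a c : ic (a *: c) = iota a *: ic c by rewrite /ic map_mxZ.
have ic_sum (r : seq W) (c : W -> 'rV[R]_m) : ic (\sum_(v <- r) c v) = \sum_(v <- r) ic (c v).
  exact: (raddf_sum (map_mx iota)).
have [s [sK Ks]] := @span_of_set F W [set v | exists2 c, v = ic c & lin c = 0].
pose U := <<s>>%VS.
have /choice[cf cfE] := linP.
pose phi x : W := coproj U (ic (cf x)).
have phiE c x : lin c = x -> phi x = coproj U (ic c).
  move=> cx; apply/eqP; rewrite -subr_eq0 -linearB coproj_eq0; apply: Ks.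
  by exists (cf x - c); [rewrite /ic map_mxB|rewrite linB -cfE cx subrr].
have loc : localization iota phi.
  split=> [a x y|x].
    rewrite (phiE (a *: cf x + cf y)); last by rewrite lin_lin -!cfE.
    by rewrite ic_lin linearP.
  split=> [/eqP|/asboolP[a a0 ax]].
    rewrite coproj_eq0.
    have -> : U = <<map idfun (undup s)>>%VS.
      by rewrite map_id; apply: eq_span => v; rewrite mem_undup.
    case/(mem_span_map (undup_uniq s)) => d dE.
    have [e e0 [a aE]] := common_denominator_frac fracs (undup s) d.
    have /choice[k kE] v : exists c, v \in s -> v = ic c /\ lin c = 0.
      have [/sK[c -> c0]|_] := boolP (v \in s); first by exists c.
      by exists 0.
    have ecx : e *: cf x = \sum_(v <- undup s) a v *: k v.
      apply: ic_inj; rewrite icZ dE scaler_sumr ic_sum.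
      apply: eq_big_seq => v vs; rewrite icZ aE // -scalerA.
      by congr (_ *: (_ *: _)); case: (kE v) => //; rewrite -mem_undup.
    apply/asboolP; exists e => //; rewrite [x]cfE -linZ ecx.
    rewrite (big_morph lin (id1 := 0) (op1 := +%R)) //.
      rewrite big1_seq // => v /andP[_ vs]; rewrite linZ.
      by have [|_ ->] := kE v; rewrite ?scaler0 // -mem_undup.
    by move=> c d'; rewrite -[c]scale1r lin_lin !scale1r.
  apply/eqP; rewrite coproj_eq0.
  have : iota a *: ic (cf x) \in U.
    by apply: Ks; exists (a *: cf x); [rewrite /ic map_mxZ|rewrite linZ -cfE].
  by rewrite rpredZeq (raddf_eq0 _ iota_inj) // (negPf a0).
exists W, phi, xs; split=> // x.
rewrite [x]cfE /lin (loc_sum loc) big_seq memv_suml // => i _.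
by rewrite (locZ loc) memvZ // memv_span // map_f // mem_tnth.
Qed.

Section Quotient.
Variables (N : lmodType R) (W : vectType F) (phi : N -> W) (xs : seq N).
Hypothesis loc : localization iota phi.
Hypothesis phi_xs : forall x, phi x \in <<map phi xs>>%VS.
Variables (I : finType) (A : {set I}) (g : I -> N).
Local Notation G := (g @` [set` A]).

Definition phi_span : {vspace W} := <<[seq phi (g i) | i <- enum A]>>%VS.

Definition quot_loc (y : quotmod G) : W := coproj phi_span (phi (repr y)).

Lemma quot_locE x : quot_loc (qproj G x) = coproj phi_span (phi x).
Proof.
apply/eqP; rewrite -subr_eq0 -linearB -(locB loc) coproj_eq0.
apply/(loc_span iota_inj fracs loc _ _ (enum_uniq _)); exists 1; first exact: oner_neq0.
have /span_imageP[c cE] : Defs.span G (repr (qproj G x) - x).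
  apply/asboolP; have := eqxx (qproj G x).
  by rewrite -{1}[qproj G x]reprK -/(qproj G _) qproj_eq.
by exists c; rewrite scale1r cE big_enum.
Qed.

Lemma quot_localization : localization iota quot_loc.
Proof.
split=> [a y z|y].
  have [x ->] := qprojP y; have [x' ->] := qprojP z.
  by rewrite -linearP !quot_locE (loc_linear loc) linearP.
have [x ->] := qprojP y; rewrite quot_locE; split=> [/eqP|].
  rewrite coproj_eq0 => /(loc_span iota_inj fracs loc _ _ (enum_uniq _))[d d0 [a dx]].
  apply/asboolP; exists d => //; rewrite -linearZ; apply/qproj0P/span_imageP.
  by exists a; rewrite dx big_enum.
move=> /asboolP[d d0]; rewrite -linearZ => /qproj0P/span_imageP[c cE].
apply/eqP; rewrite coproj_eq0; apply/(loc_span iota_inj fracs loc _ _ (enum_uniq _)).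
by exists d => //; exists c; rewrite cE big_enum.
Qed.

(** Killing the g i, i in A, in N amounts to dividing the localization by the
    span of their images. *)
Lemma generic_rank_quotmod :
  generic_rank iota (quotmod G) = (\dim <<map phi xs>> - \dim phi_span)%N.
Proof.
rewrite (generic_rank_loc iota_inj fracs (quot_localization) (xs := map (qproj G) xs)).
  rewrite -dim_coproj; last first.
    by apply/span_subvP => v /mapP[i _ ->].
  rewrite limg_span -!map_comp; congr (\dim <<_>>).
  by apply: eq_map => x /=; rewrite quot_locE.
move=> y; have [x ->] := qprojP y; rewrite quot_locE.
have := memv_img (coproj phi_span) (phi_xs x); rewrite limg_span -!map_comp.
by congr (_ \in <<_>>%VS); apply: eq_map => z /=; rewrite quot_locE.
Qed.

End Quotient.
End Ranks.

Section MatroidRank.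
Variables (F : fieldType) (R : idomainType) (iota : {rmorphism R -> F}).
Hypothesis iota_inj : injective iota.
Hypothesis fracs : forall c : F, exists2 s : R, s != 0 & exists a, iota a = iota s * c.
Variables (n : nat) (M : realizable_matroid R n).
Implicit Types (A B : {set 'I_n}).

(** The rank function of the matroid is that of a family of vectors. *)
Lemma mat_rk_span : exists (W : vectType F) (phi : mat_module M -> W),
  localization iota phi /\ forall A, mat_rk iota M A = \dim (phi_span phi A (mat_psi M)).
Proof.
have [W [phi [xs [loc phi_xs]]]] := localization_exists iota_inj fracs (mat_fg M).
exists W, phi; split=> // A.
have rank B : generic_rank iota (mat_at M B) = (\dim <<map phi xs>> - \dim (phi_span phi B (mat_psi M)))%N.
  exact: (generic_rank_quotmod iota_inj fracs loc phi_xs).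
rewrite /mat_rk !rank {1}/phi_span finset.enum_set0 /= span_nil dimv0 subn0 subKn //.
by apply/dimvS/span_subvP => v /mapP[i _ ->].
Qed.

Lemma mat_rk_le_card A : (mat_rk iota M A <= #|A|)%N.
Proof.
have [W [phi [_ rkE]]] := mat_rk_span.
by rewrite rkE (leq_trans (dim_span _)) // size_map cardE.
Qed.

Lemma mat_rk_le_rank A : (mat_rk iota M A <= mat_rank iota M)%N.
Proof.
have [W [phi [_ rkE]]] := mat_rk_span; rewrite /mat_rank !rkE; apply: dimvS.
apply: sub_span => v /mapP[i _ ->]; apply: map_f.
by rewrite mem_enum finset.in_setT.
Qed.

Lemma mat_indepP : exists (W : vectType F) (phi : mat_module M -> W),
  localization iota phi /\ forall A,
    mat_indep iota M A = free [seq phi (mat_psi M i) | i <- enum A].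
Proof.
have [W [phi [loc rkE]]] := mat_rk_span; exists W, phi; split=> // A.
by rewrite /mat_indep rkE /free size_map cardE.
Qed.

Lemma mat_indepS A B : A \subset B -> mat_indep iota M B -> mat_indep iota M A.
Proof.
have [W [phi [_ indE]]] := mat_indepP; rewrite !indE => AB.
have /perm_free-> : perm_eq [seq phi (mat_psi M i) | i <- enum B]
    ([seq phi (mat_psi M i) | i <- enum A] ++ [seq phi (mat_psi M i) | i <- enum (B :\: A)%SET]).
  rewrite -map_cat; apply/perm_map/uniq_perm; rewrite ?enum_uniq //.
    rewrite cat_uniq !enum_uniq /= andbT; apply/hasPn => i.
    by rewrite !mem_enum inE => /andP[].
  move=> i; rewrite mem_cat !mem_enum inE.
  by case: (boolP (i \in A)) => [/(fintype.subsetP AB)|].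
exact: catl_free.
Qed.

Lemma mat_indep_torsion A (c : 'I_n -> R) : mat_indep iota M A ->
    \sum_(i in A) c i *: mat_psi M i \in @torsion_pred R (mat_module M) ->
  forall i, i \in A -> c i = 0.
Proof.
have [W [phi [loc indE]]] := mat_indepP; rewrite indE => Af.
move/(loc_ker loc); rewrite -big_enum (loc_sum loc) => c0 i iA.
apply: iota_inj; rewrite rmorph0.
apply: (free_map_eq0 (c := fun i => iota (c i)) Af); last by rewrite mem_enum.
by rewrite -[RHS]c0; apply: eq_bigr => j _; rewrite (locZ loc).
Qed.

(** A torsion element of the module of the empty set that dies in that of A is
    a combination of the psi i, i in A, whose coefficients vanish. *)
Lemma torsion_map_inj A (A0 : @mat_gens R n M finset.set0 `<=` @mat_gens R n M A) :
  mat_indep iota M A -> injective (torsion_map A0).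
Proof.
move=> indA; apply: raddf_inj => x /(congr1 val) /=.
have [z zE] := qprojP (\val x); rewrite zE quot_map_qproj //.
move=> /qproj0P/span_imageP[c cE].
have : z \in @torsion_pred R (mat_module M).
  have /asboolP[a a0] := valP x; rewrite zE -linearZ => /qproj0P/span_imageP[d].
  by rewrite big_set0 => az; apply/asboolP; exists a.
rewrite cE => /(mat_indep_torsion indA) c0; apply: val_inj; rewrite zE cE big1 ?linear0 // => i iA.
by rewrite c0 ?scale0r.
Qed.

End MatroidRank.

(** * The link of the trivial character *)
Lemma card_is_preimage (T : eqType) (U : choiceType) (u0 : U) (h : U -> T)
    (A : set T) (B : set U) k :
    card_is A k -> {in B &, injective h} -> (forall u, B u -> A (h u)) ->
    (forall x, A x -> exists2 u, B u & h u = x) ->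
  card_is B k.
Proof.
move=> Ak hinj hA hsurj.
have /choice[g gP] x : exists u, A x -> B u /\ h u = x.
  have [/hsurj[u Bu hu]|nA] := pselect (A x); first by exists u.
  by exists u0.
apply: (card_is_image (f := g) Ak) => [x y /set_mem/gP[_ gx] /set_mem/gP[_ gy] gxy|x /gP[]//|u Bu].
  by rewrite -gx -gy gxy.
have [Bg gu] := gP _ (hA u Bu).
by exists (h u); [exact: hA|apply: hinj; rewrite ?inE].
Qed.

Section TorsionCounts.
Variables (F : fieldType) (R : idomainType) (iota : {rmorphism R -> F}).
Hypothesis iota_inj : injective iota.
Hypothesis fracs : forall c : F, exists2 s : R, s != 0 & exists a, iota a = iota s * c.
Hypothesis Rpid : is_PID R.
Hypothesis Rres : forall g : R, g != 0 -> exists s, residues g s.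

Lemma torsion_torsion (N : lmodType R) (x : torsion N) : exists2 a : R, a != 0 & a *: x = 0.
Proof.
have /asboolP[a a0 ax] := valP x; exists a => //.
by apply: val_inj; rewrite GRing.valZ ax.
Qed.

(** The case phi = 0 of the count of extensions. *)
Lemma card_dual_extensions (N : lmodType R) (S : set (torsion N)) p q :
    submodule S -> card_is S p -> card_is [set: torsion N] q ->
  exists2 k, card_is [set l : dual iota N |
     forall x, S x -> (l : {linear torsion N -> frac_mod iota}) x = 0] k & (k * p)%N = q.
Proof.
move=> SS Sp Tq.
have [|k ext kq] := card_extensions Rpid (frac_mod_divisible iota_inj)
  (frac_mod_torsion iota_inj) Rres (@torsion_torsion N)
  (phi := fun=> 0) SS _ Sp Tq.
  by move=> a x y _ _; rewrite scaler0 addr0.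
exists k => //.
pose h (l : dual iota N) : torsion N -> frac_mod iota := (l : {linear _ -> _}).
apply: (card_is_preimage (dual0 iota N) (h := h) ext) => [l l' _ _ ll'|l lS|f [flin fS]].
- by apply: dual_ext => x; rewrite -/(h l x) ll'.
- by split=> // a x y _ _; apply: linearP.
have flin' : linear f by move=> a x y; apply: flin.
pose l : {linear torsion N -> frac_mod iota} := HB.pack f
  (GRing.isLinear.Build R (torsion N) (frac_mod iota) *:%R f flin').
by exists l.
Qed.

Lemma card_dual (N : lmodType R) q : card_is [set: torsion N] q ->
  card_is [set: dual iota N] q.
Proof.
move=> Tq; have S0 : submodule [set (0 : torsion N)].
  by split=> // a x y /= -> ->; rewrite scaler0 addr0.
have c1 : card_is [set (0 : torsion N)] 1.
  by exists [:: 0]; split=> // x; rewrite inE; split=> [/eqP|/= ->].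
have [k kc <-] := card_dual_extensions S0 c1 Tq; rewrite muln1.
apply: (card_is_image (f := id) kc) => // l _; exists l => //= x ->.
exact: linear0.
Qed.

Variables (n : nat) (M : realizable_matroid R n).
Implicit Types (A B : {set 'I_n}).

Lemma quotmod_fg (N : lmodType R) (G : set N) : finitely_generated N ->
  finitely_generated (quotmod G).
Proof.
move=> [s sP]; exists (map (qproj G) s) => y; have [x ->] := qprojP y.
have [t [ts ->]] := sP x; exists [seq (p.1, qproj G p.2) | p <- t]; split.
  by move=> _ /mapP[p /ts pt ->]; apply: map_f.
by rewrite linear_sum big_map; apply: eq_bigr => p _; rewrite linearZ.
Qed.

Lemma card_is_torsion A : card_is [set: torsion (mat_at M A)] (card_tor M A).
Proof.
have [k kc] := finite_torsion Rres (quotmod_fg (mat_gens (M := M) A) (mat_fg M)).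
by rewrite /card_tor (card_is_fset kc).
Qed.

Lemma card_tor_dualE A : card_tor_dual iota M A = card_tor M A.
Proof. exact/card_is_fset/card_dual/card_is_torsion. Qed.

(** The characters counted are the extensions of 0 from the image of tor(empty
    set), which has as many elements as tor(empty set) by injectivity. *)
Lemma card_link_fiber A : mat_indep iota M A -> exists2 k,
  card_is [set l : tor_dual iota M A |
     tor_dual_map (finset.sub0set A) l = dual0 iota (mat_at M finset.set0)] k &
  (card_tor M finset.set0 * k)%N = card_tor_dual iota M A.
Proof.
move=> indA; pose j := torsion_map (mat_gens_subset (M := M) (finset.sub0set A)).
have SS : submodule (range j).
  split=> [|a _ _ [x _ <-] [y _ <-]]; first by exists 0 => //; apply: linear0.
  by exists (a *: x + y) => //; apply: linearP.
have Sp : card_is (range j) (card_tor M finset.set0).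
  apply: (card_is_image (f := j) (card_is_torsion finset.set0)) => [x y _ _|x _|y [x _ <-]].
  - exact: (torsion_map_inj iota_inj fracs).
  - by exists x.
  - by exists x.
have [k kc kq] := card_dual_extensions SS Sp (card_is_torsion A).
exists k; last by rewrite mulnC kq card_tor_dualE.
apply: (card_is_image (f := id) kc) => // l /= lS.
  by apply: dual_ext => x; apply: lS; exists x.
exists l => // _ [x _ <-].
by have := congr1 (fun f : dual iota _ => (f : {linear _ -> _}) x) lS.
Qed.

End TorsionCounts.

Section Link.
Variables (F : fieldType) (R : idomainType) (iota : {rmorphism R -> F}).
Hypothesis iota_inj : injective iota.
Hypothesis fracs : forall c : F, exists2 s : R, s != 0 & exists a, iota a = iota s * c.
Variables (n : nat) (M : realizable_matroid R n).
Implicit Types (A B C S : {set 'I_n}).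
Local Notation Gr := (Gr iota M).
Local Notation link := (link iota M).

Lemma tor_dual_mapE A B (s s' : A \subset B) (l : tor_dual iota M B) :
  tor_dual_map s l = tor_dual_map s' l.
Proof. by rewrite (bool_irrelevance s s'). Qed.

Lemma torsion_map_comp A B C (AB : A \subset B) (BC : B \subset C) (AC : A \subset C)
    (x : torsion (mat_at M A)) :
  torsion_map (mat_gens_subset (M := M) BC) (torsion_map (mat_gens_subset (M := M) AB) x) =
  torsion_map (mat_gens_subset (M := M) AC) x.
Proof.
apply: val_inj => /=; have [z ->] := qprojP (\val x).
by rewrite !quot_map_qproj //; apply: mat_gens_subset.
Qed.

Lemma tor_dual_map_comp A B C (AB : A \subset B) (BC : B \subset C) (AC : A \subset C)
    (l : tor_dual iota M C) :
  tor_dual_map AB (tor_dual_map BC l) = tor_dual_map AC l.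
Proof.
apply: dual_ext => x /=; congr (_ _); exact: torsion_map_comp.
Qed.

Lemma tor_dual_map_id A (AA : A \subset A) (l : tor_dual iota M A) : tor_dual_map AA l = l.
Proof.
apply: dual_ext => x /=; congr (_ _); apply: val_inj => /=.
by have [z ->] := qprojP (\val x); rewrite quot_map_qproj.
Qed.

(** The order of Gr M without chains of covering relations. *)
Definition gr_restr (g h : Gr) := exists s : gr_set g \subset gr_set h,
  tor_dual_map s (gr_char h) = gr_char g.

Lemma gr_restr_eq (g h : Gr) : gr_restr g h -> gr_set g = gr_set h -> g = h.
Proof.
case: g h => [A iA l] [B iB h] [/= s E] AB; subst B.
by rewrite -E tor_dual_map_id (bool_irrelevance iA iB).
Qed.

Lemma gr_restr_trans (g h k : Gr) : gr_restr g h -> gr_restr h k -> gr_restr g k.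
Proof.
move=> [s sE] [t tE]; have u := fintype.subset_trans s t; exists u.
by rewrite -sE -tE (tor_dual_map_comp s t u).
Qed.

Definition gr_face (g : Gr) S : Gr := MkGr
  (mat_indepS iota_inj fracs (finset.subsetIl (gr_set g) S) (gr_indep g))
  (tor_dual_map (finset.subsetIl (gr_set g) S) (gr_char g)).

Lemma gr_face_restr g S : gr_restr (gr_face g S) g.
Proof. by exists (finset.subsetIl (gr_set g) S). Qed.

Lemma gr_restr_face (g h : Gr) : gr_restr g h -> g = gr_face h (gr_set g).
Proof.
move=> [s sE]; apply: gr_restr_eq; last by apply/esym/finset.setIidPr.
have u : gr_set g \subset gr_set (gr_face h (gr_set g)).
  by rewrite /= finset.subsetI s subxx.
by exists u; rewrite (tor_dual_map_comp u _ s).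
Qed.

Lemma gr_face_face g S C : gr_face (gr_face g S) C = gr_face g (S :&: C).
Proof.
apply: gr_restr_eq; last by rewrite /= finset.setIA.
have u : gr_set (gr_face (gr_face g S) C) \subset gr_set (gr_face g (S :&: C)).
  by rewrite /= finset.setIA.
exists u; have v : gr_set (gr_face (gr_face g S) C) \subset gr_set g.
  by rewrite /= -finset.setIA finset.subsetIl.
by rewrite /= (tor_dual_map_comp u _ v) (tor_dual_map_comp _ _ v).
Qed.

Lemma gr_face_set g : gr_face g (gr_set g) = g.
Proof. by apply: gr_restr_eq (gr_face_restr _ _) _; rewrite /= finset.setIid. Qed.

(** A character restricted from h to S is reached from h by removing one element
    at a time; all intermediate sets are independent. *)
Lemma gr_leP (g h : Gr) : gr_le g h <-> gr_restr g h.
Proof.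
split=> [|gh].
  elim=> [x y [b [_ _ []]]|x|x y z _ xy _ yz].
  - by move=> s sE; exists s.
  - by exists (subxx _); apply: tor_dual_map_id.
  - exact: gr_restr_trans xy yz.
rewrite (gr_restr_face gh); move: (gr_set g) => S {gh}.
move: {2}#|gr_set h :\: S|%SET (leqnn #|gr_set h :\: S|%SET) => k.
elim: k S => [|k IH] S Sk.
  have hS : gr_set h \subset S by rewrite -finset.setD_eq0 -cards_eq0 -leqn0.
  have -> : gr_face h S = h; last exact: rt_refl.
  by apply: gr_restr_eq (gr_face_restr _ _) _; apply/finset.setIidPl.
have [hS|] := boolP (gr_set h \subset S).
  apply: IH; move: hS; rewrite -finset.setD_eq0 => /eqP->.
  by rewrite cards0.
move=> /subsetPn[b bh bS]; apply: (rt_trans _ _ _ (gr_face h (b |: S))); last first.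
  apply: IH; rewrite -ltnS; apply: leq_trans Sk; apply: proper_card.
  apply/properP; split; first by apply/finset.setDS/finset.subsetUr.
  by exists b; rewrite !inE ?eqxx // bS.
apply: rt_step; exists b; split=> /=.
- by rewrite inE bh.
- apply/finset.setP => u; rewrite !inE.
  by case: (eqVneq u b) => [->|_]; rewrite ?bh.
- have s : gr_set h :&: S \subset gr_set h :&: (b |: S).
    by apply/finset.setIS/finset.subsetUr.
  exists s; exact: tor_dual_map_comp.
Qed.

Lemma gr_leE (g h : Gr) : (g <= h)%O <-> gr_restr g h.
Proof. by rewrite -gr_leP; split=> [/asboolP|?]; last exact/asboolP. Qed.

Lemma gr0_face g S : (gr0 iota M <= g)%O -> (gr0 iota M <= gr_face g S)%O.
Proof.
move=> /gr_leE[s sE]; apply/gr_leE; exists (finset.sub0set _).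
by rewrite /= (tor_dual_map_comp _ _ s).
Qed.

Definition link_supp (x : link) : {set 'I_n} := gr_set (val x).

Definition link_face (x : link) S : link := Sub (gr_face (val x) S) (gr0_face S (valP x)).

Lemma link_labelling : simplicial_labelling link_supp link_face.
Proof.
split=> [//|x S C|x|x y].
- by apply: val_inj; apply: gr_face_face.
- by apply: val_inj; apply: gr_face_set.
split=> [xy|[S ->]].
  exists (gr_set (val x)); apply: val_inj; apply: gr_restr_face.
  by apply/gr_leE.
by apply/gr_leE/gr_face_restr.
Qed.

Hypothesis Rpid : is_PID R.
Hypothesis Rres : forall g : R, g != 0 -> exists s, residues g s.

Lemma card_link_over A : exists2 k, card_is [set x : link | link_supp x = A] k &
  (card_tor M finset.set0 * k = if mat_indep iota M A then card_tor_dual iota M A else 0)%N.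
Proof.
case: (boolP (mat_indep iota M A)) => [indA|indA]; last first.
  exists 0%N; last by rewrite muln0.
  exists [::]; split=> // x; split=> // xA.
  by move: indA; rewrite -xA (gr_indep (val x)).
have [k kc kE] := card_link_fiber iota_inj fracs Rpid Rres indA.
exists k => //.
pose lift (l : tor_dual iota M A) := MkGr indA l.
have lift0 (l : tor_dual iota M A) : (gr0 iota M <= lift l)%O <->
    tor_dual_map (finset.sub0set A) l = dual0 iota (mat_at M finset.set0).
  rewrite gr_leE; split=> [[s sE]|E]; last by exists (finset.sub0set A).
  by rewrite (tor_dual_mapE _ s).
apply: (card_is_image (f := fun l => insubd (link0 iota M) (lift l)) kc).
- move=> l l' /set_mem /lift0 gl /set_mem /lift0 gl' /(congr1 val).
  rewrite !val_insubd gl gl' => /= E.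
  have [s] : gr_restr (lift l) (lift l').
    by rewrite E; exists (subxx _); apply: tor_dual_map_id.
  by rewrite /= tor_dual_map_id.
- move=> l /lift0 gl; rewrite /= /link_supp val_insubd gl //.
- move=> x xA; case: (x) (xA) => -[B iB l] gx /= BA; rewrite /link_supp /= in BA.
  subst B; exists l; first by apply/lift0; rewrite /lift (bool_irrelevance indA iB).
  apply: val_inj; rewrite val_insubd /= /lift (bool_irrelevance indA iB).
  by rewrite gx.
Qed.

End Link.

(** * Generating series *)
Section Series.
Variable n : nat.
Implicit Types (A : {set 'I_n}) (N i k : nat).

Definition geom N : {poly int} := \sum_(j < N) 'X^j.

(** Distribute the product, over the v in A, of X + ... + X^N. *)
Lemma coef_support_series N A i : (0 < N)%N ->
  (('X * geom N) ^+ #|A|)`_i =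
  (\sum_(e : {ffun 'I_n -> 'I_N})
     ([forall v, (v \notin A) ==> (e v == 0 :> nat)] && (#|A| + \sum_v e v == i)))%N%:R.
Proof.
move=> N0; pose T v (j : 'I_N) : {poly int} :=
  if v \in A then 'X^(j.+1) else (j == 0 :> nat)%:R.
have -> : ('X * geom N) ^+ #|A| = \prod_v \sum_j T v j.
  rewrite -prodr_const [LHS]big_mkcond /=; apply: eq_bigr => v _.
  rewrite /T; case: ifP => vA.
    by rewrite /geom mulr_sumr; apply: eq_bigr => j _; rewrite exprS.
  rewrite (bigD1 (Ordinal N0)) //= big1 ?addr0 // => j.
  by rewrite -val_eqE /= => /negPf->.
rewrite bigA_distr_bigA /= coef_sum natr_sum; apply: eq_bigr => e _.
case: (boolP [forall v, _]) => [/forallP e0|/forallPn[v]] /=; last first.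
  rewrite negb_imply => /andP[vA ev]; rewrite (bigD1 v) //= /T (negPf vA) (negPf ev).
  by rewrite mul0r coef0.
have -> : \prod_v T v (e v) = 'X^(#|A| + \sum_v e v).
  rewrite exprD -prodr_const [X in X * _]big_mkcond -prodrXr -big_split /=.
  apply: eq_bigr => v _; rewrite /T; case: ifP => vA; first by rewrite exprS.
  have := implyP (e0 v); rewrite vA => /(_ isT) ev0.
  by rewrite ev0 (eqP ev0) mulr1.
by rewrite coefXn eq_sym.
Qed.

Lemma coef_mul_1subXn (Q : {poly int}) N k i : (i < N)%N ->
  (Q * (1 - 'X^N) ^+ k)`_i = Q`_i.
Proof.
move=> iN; elim: k => [|k IH]; first by rewrite mulr1.
by rewrite exprSr mulrA mulrBr mulr1 coefB coefMXn iN subr0.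
Qed.

Lemma geomE N : (1 - 'X) * geom N = 1 - 'X^N.
Proof. by rewrite -[1 - 'X^N]opprB subrX1 -mulNr opprB. Qed.

(** Truncated form of (1 - X)^n (X / (1 - X))^k = X^k (1 - X)^(n - k). *)
Lemma coef_series_mul N k i : (k <= n)%N -> (i < N)%N ->
  ((1 - 'X) ^+ n * ('X * geom N) ^+ k)`_i = ('X^k * (1 - 'X) ^+ (n - k))`_i.
Proof.
move=> kn iN; rewrite -[in LHS](subnK kn) exprD -mulrA -exprMn mulrCA geomE.
by rewrite exprMn mulrA coef_mul_1subXn // mulrC.
Qed.

End Series.

Lemma card_index_deg (d : Order.disp_t) (P : bPOrderType d) (n : nat)
    (supp : P -> {set 'I_n}) (PF : {fset P}) (N i : nat) : (0 < N)%N ->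
  #|@index_deg d P n supp PF N i|%:R =
  (\sum_(c : PF) ('X * geom N) ^+ #|supp (val c)|)`_i.
Proof.
move=> N0; rewrite -sum1_card natr_sum coef_sum.
rewrite big_mkcond -(pair_bigA _ (fun c e => if (c, e) \in index_deg supp i then 1%:R else 0)) /=.
apply: eq_bigr => c _; rewrite coef_support_series // natr_sum.
apply: eq_bigr => e _; rewrite inE /index_elt /=.
rewrite (_ : std_exp _ _ _ = [forall v, (v \notin supp (val c)) ==> (e v == 0 :> nat)]).
  rewrite (_ : \sum_v _ = \sum_v e v)%N; first by case: (_ && _).
  by apply: eq_bigr => v _; rewrite ffunE.
by apply: eq_forallb => v; rewrite ffunE.
Qed.

Lemma eval2_sum (A : comNzRingType) (I : finType) (c a b : I -> nat) (x y : A) :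
  eval2 (\sum_i (c i)%:R * ('X - 1) ^+ a i * ('Y - 1) ^+ b i) x y =
  \sum_i (c i)%:R * (x - 1) ^+ a i * (y - 1) ^+ b i.
Proof.
rewrite /eval2 rmorph_sum /= !horner_sum; apply: eq_bigr => i _.
rewrite !rmorphM !rmorphXn !rmorphB !rmorph1 !rmorph_nat /= map_polyX map_polyC /= map_polyX.
rewrite -[LHS]/(horner_eval y (horner_eval x%:P _)).
rewrite !rmorphM !rmorphXn !rmorphB !rmorph1 !rmorph_nat /=.
by rewrite /horner_eval !(hornerX, hornerC).
Qed.

(** For any field: computing with fractions of polynomials directly would unfold
    their construction. *)
Lemma power_at_inv (E : fieldType) (t : E) r n k : t != 0 -> 1 - t != 0 ->
    (k <= r)%N -> (k <= n)%N ->
  t ^+ r / (1 - t) ^+ r * (1 / t - 1) ^+ (r - k) =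
  t ^+ k * (1 - t) ^+ (n - k) / (1 - t) ^+ n.
Proof.
move=> t0 u0 kr kn; have -> : 1 / t - 1 = (1 - t) / t by rewrite mulrBl divff.
rewrite exprMn exprVn -{1 2}(subnK kr) -{2}(subnK kn) !exprD.
have := expf_neq0 k t0; have := expf_neq0 (r - k) t0.
have := expf_neq0 k u0; have := expf_neq0 (r - k) u0; have := expf_neq0 (n - k) u0.
move: (t ^+ k) (t ^+ (r - k)) ((1 - t) ^+ k) ((1 - t) ^+ (r - k)) ((1 - t) ^+ (n - k)).
by move=> a b c d e e0 d0 c0 b0 a0; field; rewrite ?a0 ?b0 ?c0 ?d0 ?e0.
Qed.

Section RationalFunction.
Local Notation t := (tofrac ('X : {poly int})).

Lemma tofracX_neq0 : t != 0.
Proof. by rewrite tofrac_eq0 polyX_eq0. Qed.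

Lemma one_subX_neq0 : 1 - 'X != 0 :> {poly int}.
Proof.
apply/eqP => /(congr1 (fun p : {poly int} => p`_0)).
by rewrite coefB coef1 coefX coef0.
Qed.

Lemma term_at_inv r n k : (k <= r)%N -> (k <= n)%N ->
  t ^+ r / (1 - t) ^+ r * (1 / t - 1) ^+ (r - k) =
  tofrac ('X^k * (1 - 'X) ^+ (n - k)) / tofrac ((1 - 'X) ^+ n).
Proof.
move=> kr kn; rewrite rmorphM !rmorphXn rmorphB rmorph1 /=.
apply: power_at_inv => //; first exact: tofracX_neq0.
by rewrite -[1](rmorph1 (@tofrac {poly int})) -rmorphB tofrac_eq0 one_subX_neq0.
Qed.

End RationalFunction.

Lemma finite_of_fibers (T : choiceType) (I : finType) (f : T -> I) :
  (forall i, exists k, card_is [set x | f x = i] k) ->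
  exists D : {fset T}, forall x, x \in D.
Proof.
move=> fib; have /fin_all_exists[t tP] : forall i, exists s : seq T, forall x, f x = i -> x \in s.
  by move=> i; have [k [s [_ _ sP]]] := fib i; exists s => x /sP.
exists [fset x in flatten (map t (enum I))]%fset => x; rewrite inE.
by apply/flattenP; exists (t (f x)); [apply: map_f; rewrite mem_enum|apply: tP].
Qed.

Lemma card_fset_fiber (T : choiceType) (I : finType) (f : T -> I) (D : {fset T}) i k :
    (forall x, x \in D) -> card_is [set x | f x = i] k ->
  #|[pred x : D | f (val x) == i]| = k.
Proof.
move=> inD fk; rewrite cardE.
have vk : card_is [set x : D | f (val x) = i] #|[pred x : D | f (val x) == i]|.
  exists (enum [pred x : D | f (val x) == i]); rewrite enum_uniq -cardE; split=> // x.
  by rewrite mem_enum inE; split=> [/eqP|/eqP].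
rewrite -cardE; apply: card_is_inj (card_is_image (f := val) vk _ _ _) fk => //.
- by move=> x y _ _; apply: val_inj.
- by move=> x fx; exists [` inD x]%fset.
Qed.

Section HilbertSeries.
Variables (F : fieldExtType rat) (R : idomainType) (iota : {rmorphism R -> F}).
Hypothesis R_int : ring_of_integers iota.
Hypothesis R_pid : is_PID R.
Variables (n : nat) (M : realizable_matroid R n) (K : fieldType).
Local Notation P := (link iota M).
Local Notation supp := (@link_supp F R iota n M).
Local Notation inj := (iota_inj R_int).
Local Notation fracs := (frac_of_integers R_int).
Local Notation Rres := (finite_residues R_int).

Lemma finite_link : exists D : {fset P}, forall x, x \in D.
Proof.
apply: (finite_of_fibers (f := supp)) => A.
by have [k ? _] := card_link_over inj fracs M R_pid Rres A; exists k.
Qed.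

Lemma face_module_graded_dim (D : {fset P}) N i : (forall x, x \in D) -> (i < N)%N ->
  has_dim (@face_module_graded F R iota n M K i)
    (card_tor M finset.set0 * #|index_deg supp (PF := D) (N := N) i|).
Proof.
move=> inD iN; apply: has_dim_rows.
  exists 0; last exact: (raddf0 (@face_proj K _ P)).
  by move=> m; rewrite msupp0.
exact: (face_ring_graded_dim K (link_labelling inj fracs M) inD iN).
Qed.

Definition hilbert_numerator : {poly int} :=
  \sum_(A : {set 'I_n} | mat_indep iota M A)
    (card_tor_dual iota M A)%:R * ('X^#|A| * (1 - 'X) ^+ (n - #|A|)).

(** The Hilbert series is tau times the sum over the link of (X / (1 - X))^|c|;
    grouping the elements c by vertex set turns tau times the size of a group
    into |tor(A)^v|. *)
Lemma hilbert_numerator_coef i :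
  \sum_(j < i.+1) ((1 - 'X) ^+ n : {poly int})`_j * (hilbert_series iota M K (i - j))%:Z
    = hilbert_numerator`_i.
Proof.
have [D inD] := finite_link; pose N := i.+1.
pose H := (card_tor M finset.set0)%:R * \sum_(c : D) ('X * geom N) ^+ #|supp (val c)|.
transitivity (((1 - 'X) ^+ n * H)`_i).
  rewrite coefM; apply: eq_bigr => j _; congr (_ * _).
  rewrite /hilbert_series (has_dim_vdim (face_module_graded_dim inD _ (N := N))) ?ltnS ?leq_subr //.
  by rewrite /H mulr_natl coefMn -card_index_deg // -mulrnA natz mulnC.
rewrite /H mulrCA mulr_sumr mulr_sumr coef_sum.
transitivity (\sum_(c : D) ((card_tor M finset.set0)%:R * ('X^#|supp (val c)| * (1 - 'X) ^+ (n - #|supp (val c)|)) : {poly int})`_i).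
  apply: eq_bigr => c _; rewrite !mulr_natl !coefMn coef_series_mul //.
  by rewrite -[n in (_ <= n)%N]card_ord max_card.
rewrite -coef_sum (_ : \sum_(c : D) _ = hilbert_numerator) //.
rewrite (partition_big (fun c : D => supp (val c)) predT) //= /hilbert_numerator [RHS]big_mkcond /=.
apply: eq_bigr => A _.
rewrite (eq_bigr (fun=> (card_tor M finset.set0)%:R * ('X^#|A| * (1 - 'X) ^+ (n - #|A|)))); last first.
  by move=> c /eqP->.
have [k kA kE] := card_link_over inj fracs M R_pid Rres A.
rewrite sumr_const (card_fset_fiber inD kA) -mulrnAl -mulrnA kE.
by case: ifP => // _; rewrite mul0r.
Qed.

(** 0 ^ k is 0 unless k = 0, so y = 1 selects the A with #|A| <= rk A. *)
Lemma eval_tutte_poly (x : {fraction {poly int}}) :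
  eval2 (tutte_poly iota M) x 1 = \sum_(A : {set 'I_n} | mat_indep iota M A)
    (card_tor_dual iota M A)%:R * (x - 1) ^+ (mat_rank iota M - #|A|).
Proof.
rewrite /tutte_poly eval2_sum [RHS]big_mkcond; apply: eq_bigr => A _.
rewrite subrr expr0n subn_eq0 /mat_indep eqn_leq (mat_rk_le_card inj fracs) /=.
case: leqP => [Ark|_]; rewrite ?mulr0 // mulr1.
suff -> : mat_rk iota M A = #|A| by [].
by apply/eqP; rewrite eqn_leq Ark (mat_rk_le_card inj fracs).
Qed.

End HilbertSeries.

Theorem theorem5p4
    (F : fieldExtType rat) (R : idomainType) (iota : {rmorphism R -> F})
    (R_int : ring_of_integers iota) (R_pid : is_PID R)
    (n r : nat) (M : realizable_matroid R n) (M_rank : mat_rank iota M = r)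
    (K : fieldType) :
  (forall i, finite_dim (@face_module_graded F R iota n M K i)) /\
  (let t : {fraction {poly int}} := tofrac 'X in
   power_series_of
     (t ^+ r / (1 - t) ^+ r * eval2 (tutte_poly iota M) (1 / t) 1)
     (fun i => (hilbert_series iota M K i)%:Z)).
Proof.
split=> [i|].
  have [D inD] := finite_link R_int R_pid M.
  by exists (card_tor M finset.set0 * #|index_deg (@link_supp F R iota n M) (PF := D) (N := i.+1) i|)%N;
    apply: face_module_graded_dim.
move=> t; exists (hilbert_numerator iota M), ((1 - 'X) ^+ n); split.
- rewrite -horner_coef0 horner_exp !hornerE expr1n oner_eq0 //.
- rewrite eval_tutte_poly // rmorph_sum mulr_sumr mulr_suml; apply: eq_bigr => A indA.
  have An : (#|A| <= n)%N by rewrite -[n in (_ <= n)%N]card_ord max_card.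
  have Ar : (#|A| <= r)%N.
    by rewrite -M_rank -(eqP indA) (mat_rk_le_rank (iota_inj R_int) (frac_of_integers R_int)).
  rewrite M_rank mulrCA (term_at_inv Ar An) [in RHS]rmorphM [in RHS]rmorph_nat mulrA.
  by congr (_ * _ / _).
- by move=> i; apply: hilbert_numerator_coef.
Qed.
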